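(* Let $f:\mathbb{R}^p\to\mathbb{R}\cup\{+\infty\}$ and $g:\mathbb{R}^n\to\mathbb{R}\cup\{+\infty\}$ be proper, closed and convex, let $K:\mathbb{R}^p\to\mathbb{R}^n$ be linear, assume that the solution set $\mathcal{X}^\star$ of the primal problem $F^\star=\min_{x}\{F(x):=f(x)+g(Kx)\}$ is nonempty and that $0\in\mathrm{ri}(\mathrm{dom}(g)-K\,\mathrm{dom}(f))$. Let $\rho_0>0$, $\gamma\in(0,1)$, and let $\{(x^k,\bar y^k)\}$ be generated by Algorithm 1 (defined in the context) with $c:=1$, started from $x^0\in\mathbb{R}^p$, $y^0\in\mathbb{R}^n$. Then for any given $x,x^0\in\mathbb{R}^p$, $y,y^0\in\mathbb{R}^n$ and all $k\ge 1$, $$\widetilde{\mathcal{L}}(x^k,y)-\widetilde{\mathcal{L}}(x,\bar y^k)\le\frac{1}{2k}\left[\frac{\rho_0\|K\|^2\|x^0-x\|^2}{\gamma}+\frac{\|y^0-y\|^2}{(1-\gamma)\rho_0}\right].$$ Furthermore, the following statements hold: (a) (Semi-ergodic convergence on the primal-dual gap.) Let $\mathcal{X}\subseteq\mathbb{R}^p$ and $\mathcal{Y}\subseteq\mathbb{R}^n$ be nonempty, closed, convex sets with $\mathcal{X}^\star\cap\mathcal{X}\ne\emptyset$ and $\mathcal{Y}^\star\cap\mathcal{Y}\neq\emptyset$. Then the gap function $\mathcal{G}_{\mathcal{X}\times\mathcal{Y}}$ satisfies, for all $k\ge1$, $$0\le\mathcal{G}_{\mathcal{X}\times\mathcal{Y}}(x^k,\bar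 y^k)\le\frac{1}{2k}\sup_{(x,y)\in\mathcal{X}\times\mathcal{Y}}\left[\frac{\rho_0\|K\|^2\|x^0-x\|^2}{\gamma}+\frac{\|y^0-y\|^2}{(1-\gamma)\rho_0}\right].$$ Hence, the primal-dual gap sequence $\{\mathcal{G}_{\mathcal{X}\times\mathcal{Y}}(x^k,\bar y^k)\}$ converges to zero at an $O(1/k)$ rate in the semi-ergodic sense, i.e., non-ergodic in $x^k$ and ergodic in $\bar y^k$. (b) (Non-ergodic convergence on the primal objective.) If $g$ is $M_g$-Lipschitz continuous on $\mathrm{dom}(g)$ and $x^\star$ is an optimal solution of the primal problem, then for all $k\ge1$ the primal objective residual based on the last-iterate sequence $\{x^k\}$ satisfies $$0\le F(x^k)-F^\star\le\frac{1}{2k}\left[\frac{\rho_0\|K\|^2\|x^0-x^\star\|^2}{\gamma}+\frac{D_g^2}{(1-\gamma)\rho_0}\right],\qquad D_g:=\sup\{\|y^0-y\| : \|y\|\le M_g\}.$$ Hence, $\{F(x^k)\}$ converges to the primal optimal value $F^\star$ at an $O(1/k)$ rate in the non-ergodic sense. (c) (Ergodic convergence on the dual objective.) If $f^*$ is $M_{f^*}$-Lipschitz continuous on $\mathrm{dom}(f^* )$ and $y^\star$ is an optimal solution of the dual problem, then for all $k\ge1$ the dual objective residual based on the averaging sequence $\{\bar y^k\}$ satisfies $$0\le G(\bar y^k)-G^\star\le\frac{1}{2k}\left[\frac{\rho_0\|K\|^2D_{f^*}^2}{\gamma}+\frac{\|y^0-y^\star\|^2}{(1-\gamma)\rho_0}\right],\qquad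 D_{f^*}:=\sup\{\|x^0-x\| : \|x\|\le M_{f^*}\}.$$ Hence, $\{G(\bar y^k)\}$ converges to the dual optimal value $G^\star$ at an $O(1/k)$ rate in the ergodic sense.
   Context: $f^*,g^*$ are Fenchel conjugates; $\mathrm{ri}$ is the relative interior; $\|K\|$ is the operator norm; $\mathrm{prox}_h(x):=\arg\min_y\{h(y)+\frac12\|y-x\|^2\}$. A function $h$ is $M$-Lipschitz continuous on $\mathrm{dom}(h)=\{x: h(x)<+\infty\}$, with $M\in[0,+\infty)$, if $|h(x)-h(y)|\le M\|x-y\|$ for all $x,y\in\mathrm{dom}(h)$. ''Non-ergodic'' refers to the last iterate of a sequence and ''ergodic'' to an averaged sequence. The dual problem is $G^\star:=\min_{y\in\mathbb{R}^n}\{G(y):=f^*(-K^\top y)+g^*(y)\}$, with solution set $\mathcal{Y}^\star$. Lagrange function: $\widetilde{\mathcal{L}}(x,y):=f(x)+\langle Kx,y\rangle-g^*(y)$. Gap function: $\mathcal{G}_{\mathcal{X}\times\mathcal{Y}}(x,y):=\sup_{(\hat x,\hat y)\in\mathcal{X}\times\mathcal{Y}}\{\widetilde{\mathcal{L}}(x,\hat y)-\widetilde{\mathcal{L}}(\hat x,y)\}$. Algorithm 1. Inputs: $x^0\in\mathbb{R}^p$, $y^0\in\mathbb{R}^n$, $\rho_0>0$, $c\ge1$, $\gamma\in(0,1)$. Set $\tau_0:=1$, $x^{-1}:=\hat x^0:=x^0$, $\tilde y^{-1}:=\tilde y^0:=\bar y^0:=y^0$. For $k=0,1,2,\dots$: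 1. $\rho_k:=\frac{\rho_0}{\tau_k}$, $\beta_k:=\frac{\gamma}{\|K\|^2\rho_k}$, $\eta_k:=(1-\gamma)\rho_k$, $\tau_{k+1}:=\frac{c}{k+c+1}$ (so $\tau_k=\frac{c}{k+c}$ for all $k\ge0$). 2. $y^{k+1}:=\mathrm{prox}_{\rho_kg^*}(\tilde y^k+\rho_kK\hat x^k)$; $x^{k+1}:=\mathrm{prox}_{\beta_kf}(\hat x^k-\beta_kK^\top y^{k+1})$; $\hat x^{k+1}:=x^{k+1}+\frac{\tau_{k+1}(1-\tau_k)}{\tau_k}(x^{k+1}-x^k)$. 3. $\tilde y^{k+1}:=\tilde y^k+\eta_kK[x^{k+1}-\hat x^k-(1-\tau_k)(x^k-\hat x^{k-1})]+(1-\gamma)\left[y^{k+1}-\tilde y^k-\frac{\tau_{k-1}(1-\tau_k)}{\tau_k}(y^k-\tilde y^{k-1})\right]$. 4. $\bar y^{k+1}:=(1-\tau_k)\bar y^k+\tau_ky^{k+1}$. At $k=0$ the terms in step 3 multiplied by $1-\tau_0=0$ (involving $\hat x^{-1}$, $\tau_{-1}$) vanish.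
   Formalization: K is nonzero; the O(1/k) rate in (a) is stated when the supremum on the right is finite; in (b) and (c) the upper bound is stated for k with Kx^k in dom(g), resp. -K^T ȳ^k in dom(f^* ), and the rate when this holds for all large k, since otherwise the residual is +infinity. *)

(* Defs.v *)
From HB Require Import structures.
From mathcomp Require Import all_boot all_order all_algebra.
From mathcomp Require Import all_classical all_reals all_analysis.

Set Implicit Arguments.
Unset Strict Implicit.
Unset Printing Implicit Defensive.

Import Order.TTheory GRing.Theory Num.Theory.
Import numFieldNormedType.Exports.

Local Open Scope classical_set_scope.
Local Open Scope ring_scope.

Section Euclidean.
Context {R : realType}.

Definition dot (m : nat) (u v : 'cV[R]_m) : R := \sum_(i < m) u i 0 * v i 0.

(* The norm `|u| of the library on matrices is the sup norm, hence this
   definition of the Euclidean norm. The topology is the same. *)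
Definition enorm (m : nat) (u : 'cV[R]_m) : R := Num.sqrt (dot u u).

Definition opnorm (n p : nat) (K : 'M[R]_(n, p)) : R :=
  sup [set enorm (K *m x) | x in [set x : 'cV[R]_p | enorm x <= 1]].

Definition aff (m : nat) (C : set 'cV[R]_m) : set 'cV[R]_m :=
  [set z | exists (N : nat) (l : 'I_N -> R) (c : 'I_N -> 'cV[R]_m),
     [/\ forall i, C (c i), \sum_(i < N) l i = 1
       & z = \sum_(i < N) l i *: c i]].

Definition ri (m : nat) (C : set 'cV[R]_m) : set 'cV[R]_m :=
  [set z | C z /\ exists2 e : R, 0 < e &
     forall w, aff C w -> enorm (w - z) < e -> C w].

End Euclidean.

(* Functions into R u {+oo} are functions into \bar R that never take the
   value -oo; the latter is part of properness. *)
Section ConvexFunctions.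
Context {R : realType} {m : nat}.
Implicit Type h : 'cV[R]_m -> \bar R.
Local Open Scope ereal_scope.

Definition dom h : set 'cV[R]_m := [set x | h x < +oo].

Definition proper_efun h : Prop := (forall x, h x != -oo) /\ dom h !=set0.

(* Meaningful because h never takes the value -oo, and 0 * +oo = 0. *)
Definition convex_efun h : Prop :=
  forall x y (t : R), (0 <= t <= 1)%R ->
    h (t *: x + (1 - t) *: y)%R <= t%:E * h x + (1 - t)%:E * h y.

Definition proper_closed_convex h : Prop :=
  [/\ proper_efun h, lower_semicontinuous h & convex_efun h].

Definition lipschitz_on_dom (M : R) h : Prop :=
  forall x y, dom h x -> dom h y -> `|h x - h y| <= (M * enorm (x - y))%:E.

Definition fconj h (u : 'cV[R]_m) : \bar R :=
  ereal_sup [set (dot u x)%:E - h x | x in [set: 'cV[R]_m]].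

Definition argmin h : set 'cV[R]_m := [set x | forall z, h x <= h z].

(* The set of minimizers; a singleton when h is proper, closed and convex. *)
Definition prox h (x : 'cV[R]_m) : set 'cV[R]_m :=
  argmin (fun y => h y + (2^-1 * enorm (y - x) ^+ 2)%:E).

End ConvexFunctions.

Section PrimalDual.
Context {R : realType} {n p : nat}.
Variables (f : 'cV[R]_p -> \bar R) (g : 'cV[R]_n -> \bar R) (K : 'M[R]_(n, p)).
Local Open Scope ereal_scope.

Definition primal_obj (x : 'cV[R]_p) : \bar R := f x + g (K *m x).

Definition primal_value : \bar R := ereal_inf (range primal_obj).

Definition primal_sol : set 'cV[R]_p := argmin primal_obj.

Definition dual_obj (y : 'cV[R]_n) : \bar R := fconj f (- (K^T *m y))%R + fconj g y.

Definition dual_value : \bar R := ereal_inf (range dual_obj).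

Definition dual_sol : set 'cV[R]_n := argmin dual_obj.

Definition lagrangian (x : 'cV[R]_p) (y : 'cV[R]_n) : \bar R :=
  f x + (dot (K *m x) y)%:E - fconj g y.

Definition gap (X : set 'cV[R]_p) (Y : set 'cV[R]_n)
    (x : 'cV[R]_p) (y : 'cV[R]_n) : \bar R :=
  ereal_sup [set lagrangian x y' - lagrangian x' y | x' in X & y' in Y].

Definition domain_qualification : Prop :=
  ri [set (u - K *m v)%R | u in dom g & v in dom f] 0%R.

End PrimalDual.

Section Algorithm.
Context {R : realType} {n p : nat}.
Variables (f : 'cV[R]_p -> \bar R) (g : 'cV[R]_n -> \bar R) (K : 'M[R]_(n, p)).
Variables (rho0 c gamma : R).

Definition tau (k : nat) : R := if k is j.+1 then c / (j%:R + c + 1) else 1.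

Definition rho (k : nat) : R := rho0 / tau k.

Definition beta (k : nat) : R := gamma / (opnorm K ^+ 2 * rho k).

Definition eta (k : nat) : R := (1 - gamma) * rho k.

(* xh, yt and yb stand for \hat x, \tilde y and \bar y. The index k - 1 is
   k.-1, which is 0 at k = 0: there every term with that index is multiplied
   by 1 - tau 0 = 0. *)
Record algorithm1 (x0 : 'cV[R]_p) (y0 : 'cV[R]_n)
    (x xh : nat -> 'cV[R]_p) (y yt yb : nat -> 'cV[R]_n) : Prop := {
  alg_x0 : x 0%N = x0;
  alg_xh0 : xh 0%N = x0;
  alg_y0 : y 0%N = y0;
  alg_yt0 : yt 0%N = y0;
  alg_yb0 : yb 0%N = y0;
  alg_y : forall k,
    prox (fun u => (rho k)%:E * fconj g u)%E
      (yt k + rho k *: (K *m xh k)) (y k.+1);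
  alg_x : forall k,
    prox (fun u => (beta k)%:E * f u)%E
      (xh k - beta k *: (K^T *m y k.+1)) (x k.+1);
  alg_xh : forall k,
    xh k.+1 =
      x k.+1 + (tau k.+1 * (1 - tau k) / tau k) *: (x k.+1 - x k);
  alg_yt : forall k,
    yt k.+1 =
      yt k
      + eta k *: (K *m (x k.+1 - xh k - (1 - tau k) *: (x k - xh k.-1)))
      + (1 - gamma) *: (y k.+1 - yt k
          - (tau k.-1 * (1 - tau k) / tau k) *: (y k - yt k.-1));
  alg_yb : forall k,
    yb k.+1 = (1 - tau k) *: yb k + tau k *: y k.+1
}.

Definition weighted_dist2 (dx dy : R) : R :=
  rho0 * opnorm K ^+ 2 * dx ^+ 2 / gamma + dy ^+ 2 / ((1 - gamma) * rho0).

End Algorithm.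

(* sup {||z0 - z|| : ||z|| <= M} *)
Definition ball_dist (R : realType) (m : nat) (z0 : 'cV[R]_m) (M : R) : R :=
  sup [set enorm (z0 - z) | z in [set z : 'cV[R]_m | enorm z <= M]].

Definition cvg_rate_1k (R : realType) (u : nat -> \bar R) (l : \bar R) : Prop :=
  u @ \oo --> l /\
  exists C : R, \forall k \near \oo, (`|u k - l| <= (C / k%:R)%:E)%E.

(* Main.v *)
Require Import Defs.
From HB Require Import structures.
From mathcomp Require Import all_boot all_order all_algebra.
From mathcomp Require Import all_classical all_reals all_analysis.
From mathcomp Require Import ring lra.
Import Order.TTheory GRing.Theory Num.Theory.
Import numFieldNormedType.Exports.
Local Open Scope classical_set_scope.
Local Open Scope ring_scope.

Set Implicit Arguments.
Unset Strict Implicit.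
Unset Printing Implicit Defensive.

(** The convergence bound comes from an energy that the algorithm decreases. Let
   r k be the point of the domain of g that the k-th prox step for g^* yields by
   Moreau's decomposition: r k is a subgradient of g^* at y k, so that
   g (r k) = <r k, y k> - g^* (y k). For fixed u and v, consider k times the
   augmented Lagrangian gap

     f (x k) + g (r k) + <K x k - r k, v> + rho_(k-1) / 2 |K x k - r k|^2
       - L (u, yb k)

   plus multiples of |z k - u|^2 and |yt k - v|^2, where z is the auxiliary
   sequence of Nesterov's acceleration, x k.+1 being the mean with weights
   1 - tau k and tau k of x k and z k.+1. For c = 1 all weights are rational in k
   and the recursions, multiplied by k + 1, become exact: the residual
   Q k = k (K x k - r k) satisfies
   yt k.+1 - yt k = (1 - gamma) rho0 (Q k.+1 - Q k). Each step uses the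
   subgradient inequality of the prox step for f at u and at x k, that of the
   subgradient r k of g^* at y k.+1, and the convexity of g^* at yb k.+1; the
   remainder is a quadratic form that the choice of
   beta k = gamma / (|K|^2 rho k) and eta k = (1 - gamma) rho k makes nonpositive
   ([energy_step], [energy_decr]). By Young's inequality
   L (x k, v) <= f (x k) + g (r k) + <K x k - r k, v>, which gives
   [lagrangian_gap_fin], the bound on L (x k, v) - L (u, yb k) for u in the domain
   of f and v in that of g^*.

   The other statements choose u and v. Weak duality gives
   - G (y) <= L (x, y) <= F (x), so the gap at a pair of solutions is nonnegative
   once F^* = - G^*. For the primal residual, v is a subgradient of g at K x k,
   which makes L (x k, v) equal to F (x k); for the dual residual, u is a
   subgradient of f^* at - K^T yb k, and Fenchel-Moreau gives
   L (u, yb k) = - G (yb k). The Lipschitz constants bound the norms of v and u.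

   Strong duality, Fenchel-Moreau, the properness of conjugates and the existence
   of bounded subgradients all ask for an affine function below a convex one.
   They are derived from one separation result, [sandwich]: a convex epigraph
   above - N |.| lies above a linear form of norm at most N. Each application then
   only has to bound a convex function below by a cone. The hypothesis of the
   sandwich is immediate for Lipschitz functions, follows from lower
   semicontinuity for the conjugates, and from the relative interior condition for
   the value function w |-> inf_v f v + g (K v + w), whose subgradients at 0 are
   the dual solutions. *)

(** * Euclidean space *)

Section Euclid.
Context {R : realType}.

Section Dot.
Context {m : nat}.
Implicit Types u v w : 'cV[R]_m.

Lemma dotC u v : dot u v = dot v u.
Proof. by apply: eq_bigr => i _; rewrite mulrC. Qed.

Lemma dotDl u v w : dot (u + v) w = dot u w + dot v w.
Proof.
by rewrite /dot -big_split; apply: eq_bigr => i _; rewrite mxE mulrDl.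
Qed.

Lemma dotZl a u w : dot (a *: u) w = a * dot u w.
Proof. by rewrite /dot mulr_sumr; apply: eq_bigr => i _; rewrite mxE mulrA. Qed.

Lemma dotNl u w : dot (- u) w = - dot u w.
Proof. by rewrite -scaleN1r dotZl mulN1r. Qed.

Lemma dotBl u v w : dot (u - v) w = dot u w - dot v w.
Proof. by rewrite dotDl dotNl. Qed.

Lemma dotDr u v w : dot w (u + v) = dot w u + dot w v.
Proof. by rewrite dotC dotDl !(dotC w). Qed.

Lemma dotZr a u w : dot w (a *: u) = a * dot w u.
Proof. by rewrite dotC dotZl dotC. Qed.

Lemma dotNr u w : dot w (- u) = - dot w u.
Proof. by rewrite dotC dotNl dotC. Qed.

Lemma dotBr u v w : dot w (u - v) = dot w u - dot w v.
Proof. by rewrite dotDr dotNr. Qed.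

Lemma dot0l w : dot 0 w = 0.
Proof. by rewrite -(scale0r w) dotZl mul0r. Qed.

Lemma dot0r w : dot w 0 = 0.
Proof. by rewrite dotC dot0l. Qed.

Lemma dot_ge0 u : 0 <= dot u u.
Proof. by apply: sumr_ge0 => i _; rewrite -expr2 sqr_ge0. Qed.

Lemma enorm_ge0 u : 0 <= enorm u.
Proof. exact: sqrtr_ge0. Qed.

Lemma enorm2 u : enorm u ^+ 2 = dot u u.
Proof. by rewrite sqr_sqrtr ?dot_ge0. Qed.

Lemma enormZ a u : enorm (a *: u) = `|a| * enorm u.
Proof. by rewrite /enorm dotZl dotZr mulrA -expr2 sqrtrM ?sqr_ge0// sqrtr_sqr. Qed.

Lemma enormN u : enorm (- u) = enorm u.
Proof. by rewrite -scaleN1r enormZ normrN1 mul1r. Qed.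

Lemma enormB u v : enorm (u - v) = enorm (v - u).
Proof. by rewrite -enormN opprB. Qed.

Lemma enorm0 : enorm (0 : 'cV[R]_m) = 0.
Proof. by rewrite /enorm dot0l sqrtr0. Qed.

Lemma ler_abs_enorm u i : `|u i 0| <= enorm u.
Proof.
rewrite -(ler_pXn2r (n := 2)) ?nnegrE ?enorm_ge0// enorm2 /dot (bigD1 i)//=.
rewrite real_normK ?num_real// -expr2 lerDl.
by apply: sumr_ge0 => j _; rewrite -expr2 sqr_ge0.
Qed.

Lemma dot_eq0 u : dot u u = 0 -> u = 0.
Proof.
move=> u0; apply/matrixP => i j; rewrite ord1 mxE; apply/eqP.
by rewrite -normr_le0 (le_trans (ler_abs_enorm u i))// /enorm u0 sqrtr0.
Qed.

(** Cauchy-Schwarz: the squared norm of |v|^2 u - <u, v> v is nonnegative. *)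
Lemma dot_le_enorm u v : dot u v <= enorm u * enorm v.
Proof.
have [v0|v_neq0] := eqVneq (dot v v) 0.
  by rewrite (dot_eq0 v0) dot0r mulr_ge0 ?enorm_ge0.
have vv : 0 < dot v v by rewrite lt_neqAle eq_sym v_neq0 dot_ge0.
have := dot_ge0 (dot v v *: u - dot u v *: v).
rewrite !(dotBl, dotBr, dotZl, dotZr) (dotC v u) => h.
have {}h : dot u v ^+ 2 <= dot u u * dot v v.
  by rewrite -(ler_pM2l vv); nra.
apply: (le_trans (ler_norm _)).
rewrite -(ler_pXn2r (n := 2)) ?nnegrE ?mulr_ge0 ?enorm_ge0//.
by rewrite real_normK ?num_real// exprMn !enorm2.
Qed.

Lemma ler_enormD u v : enorm (u + v) <= enorm u + enorm v.
Proof.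
rewrite -(ler_pXn2r (n := 2)) ?nnegrE ?addr_ge0 ?enorm_ge0//.
rewrite sqrrD !enorm2 !(dotDl, dotDr) (dotC v u).
have := dot_le_enorm u v; lra.
Qed.

Lemma ler_norm_enorm u : `|u| <= enorm u.
Proof.
rewrite -[leLHS]/(Num.norm u) /Num.norm/= mx_normrE.
apply: bigmax_le; first exact: enorm_ge0.
by move=> [i j] _ /=; rewrite ord1 ler_abs_enorm.
Qed.

(** The Euclidean balls form a basis of neighbourhoods; the sup norm is the
   smaller one, so each sup-norm ball contains a Euclidean ball. *)
Lemma nbhs_enorm_ball u (A : set 'cV[R]_m) : nbhs u A ->
  exists2 e : R, 0 < e & forall v, enorm (v - u) < e -> A v.
Proof.
move=> /nbhs_normP[e /= e0 eA]; exists e => // v ve; apply: eA.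
by rewrite /= distrC; apply: le_lt_trans ve; exact: ler_norm_enorm.
Qed.

End Dot.

Lemma dot_trmx (n p : nat) (K : 'M[R]_(n, p)) (x : 'cV[R]_p) (y : 'cV[R]_n) :
  dot (K *m x) y = dot x (K^T *m y).
Proof.
rewrite /dot; under eq_bigr do rewrite mxE mulr_suml.
rewrite exchange_big; apply: eq_bigr => j _; rewrite mxE mulr_sumr.
by apply: eq_bigr => i _; rewrite mxE; ring.
Qed.

Section Opnorm.
Variables (n p : nat) (K : 'M[R]_(n, p)).

Lemma opnorm_has_sup :
  has_sup [set enorm (K *m x) | x in [set x : 'cV[R]_p | enorm x <= 1]].
Proof.
split; first by exists (enorm (K *m 0)), 0 => //=; rewrite enorm0.
exists (\sum_(j < p) enorm (col j K)) => _ [x /= x1 <-].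
have -> : K *m x = \sum_(j < p) x j 0 *: col j K.
  apply/matrixP => i j; rewrite mxE summxE ord1.
  by apply: eq_bigr => l _; rewrite !mxE mulrC.
have h (s : seq 'I_p) : enorm (\sum_(j <- s) x j 0 *: col j K)
    <= \sum_(j <- s) enorm (col j K).
  elim/big_ind2: _ => [|a b c d ab cd|j _]; first by rewrite enorm0.
    by apply: (le_trans (ler_enormD _ _)); exact: lerD.
  rewrite enormZ ler_piMl ?enorm_ge0//.
  exact: le_trans (ler_abs_enorm _ _) x1.
exact: h.
Qed.

Lemma enorm_mulmx_le (x : 'cV[R]_p) : enorm (K *m x) <= opnorm K * enorm x.
Proof.
have [x0|x_neq0] := eqVneq (enorm x) 0.
  have -> : x = 0 by apply: dot_eq0; rewrite -enorm2 x0 expr0n.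
  by rewrite mulmx0 !enorm0 mulr0.
have x_gt0 : 0 < enorm x by rewrite lt_neqAle eq_sym x_neq0 enorm_ge0.
rewrite -ler_pdivrMr//.
apply: (ub_le_sup opnorm_has_sup.2); exists ((enorm x)^-1 *: x).
  by rewrite /= enormZ ger0_norm ?invr_ge0 ?enorm_ge0// mulVf.
by rewrite -scalemxAr enormZ ger0_norm ?invr_ge0 ?enorm_ge0// mulrC.
Qed.

Lemma opnorm_ge0 : 0 <= opnorm K.
Proof.
apply: (@le_trans _ _ (enorm (K *m 0))); first exact: enorm_ge0.
apply: (ub_le_sup opnorm_has_sup.2); exists 0 => //=.
by rewrite enorm0.
Qed.

Lemma opnorm_gt0 : K != 0 -> 0 < opnorm K.
Proof.
move=> K_neq0; rewrite lt_neqAle opnorm_ge0 andbT eq_sym.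
apply: contra K_neq0 => /eqP K0; apply/eqP/matrixP => i j; rewrite mxE.
have := enorm_mulmx_le (delta_mx j 0); rewrite K0 mul0r => h.
have /(le_trans (ler_abs_enorm (K *m delta_mx j 0) i)) := h.
by rewrite -colE mxE normr_le0 => /eqP.
Qed.

End Opnorm.

Lemma enorm_le_ball_dist (m : nat) (z0 z : 'cV[R]_m) (M : R) :
  enorm z <= M -> enorm (z0 - z) <= ball_dist z0 M.
Proof.
move=> zM; apply: ub_le_sup; last by exists z.
exists (enorm z0 + M) => _ [w /= wM <-].
by apply: (le_trans (ler_enormD _ _)); rewrite enormN lerD2l.
Qed.

End Euclid.


(** * Hahn-Banach separation *)

Section HahnBanach.
Context {R : realType} {m : nat}.
Implicit Types (p q : 'cV[R]_m -> R) (e x y v : 'cV[R]_m).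

(** For positive [a] the inequality gives the equality [p (a *: x) = a * p x],
   by applying it to [a^-1] as well. *)
Definition sublinear p : Prop :=
  (forall a x, 0 < a -> p (a *: x) <= a * p x) /\
  (forall x y, p (x + y) <= p x + p y).

Lemma sublinear0 p : sublinear p -> p 0 = 0.
Proof.
move=> [hom _]; apply/eqP; rewrite eq_le.
have := hom 2%:R 0 ltac:(lra); have := hom 2^-1 0 ltac:(lra).
rewrite !scaler0; lra.
Qed.

Lemma sublinearZ p a x : sublinear p -> 0 <= a -> p (a *: x) = a * p x.
Proof.
move=> sp; rewrite le_eqVlt => /predU1P[<-|a0].
  by rewrite scale0r mul0r sublinear0.
apply/eqP; rewrite eq_le sp.1//= -ler_pdivlMl// mulrC.
have := sp.1 a^-1 (a *: x); rewrite scalerA mulVf ?gt_eqF// scale1r invr_gt0.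
by rewrite mulrC; exact.
Qed.

Lemma sublinear_opp p x : sublinear p -> - p (- x) <= p x.
Proof.
by move=> sp; have := sp.2 x (- x); rewrite subrr sublinear0//; lra.
Qed.

(** Taking the infimum along the half line of direction [e], corrected by the
   slope [p e], pushes the value at [- e] down to [- p e] and keeps the
   functional sublinear, so that it becomes odd at [e]. *)
Definition straighten p e x : R :=
  inf [set p (x + t *: e) - t * p e | t in [set t | 0 <= t]].

Section Straighten.
Variables (p : 'cV[R]_m -> R) (e : 'cV[R]_m).
Hypothesis sp : sublinear p.

Let S x := [set p (x + t *: e) - t * p e | t in [set t | 0 <= t]].

Lemma straighten_lb x : has_lbound (S x).
Proof.
exists (- p (- x)) => _ [t /= t0 <-].
have := sp.2 (x + t *: e) (- x); rewrite addrAC subrr add0r sublinearZ//; lra.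
Qed.

Lemma straighten_nonempty x : S x !=set0.
Proof. by exists (p (x + 0 *: e) - 0 * p e), 0 => /=. Qed.

Lemma straighten_leP x t : 0 <= t -> straighten p e x <= p (x + t *: e) - t * p e.
Proof. by move=> t0; apply: (ge_inf (straighten_lb x)); exists t. Qed.

Lemma straighten_le x : straighten p e x <= p x.
Proof.
by have := straighten_leP x (lexx 0); rewrite scale0r addr0 mul0r subr0.
Qed.

Lemma sublinear_straighten : sublinear (straighten p e).
Proof.
split=> [a x a0|x y].
  rewrite -ler_pdivrMl//; apply: (lb_le_inf (straighten_nonempty x)).
  move=> _ [t /= t0 <-]; rewrite ler_pdivrMl//.
  apply: (le_trans (straighten_leP (a *: x) (mulr_ge0 (ltW a0) t0))).
  by rewrite -scalerA -scalerDr sublinearZ ?(ltW a0)// mulrBr mulrA.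
rewrite -lerBlDr; apply: (lb_le_inf (straighten_nonempty x)) => _ [t /= t0 <-].
rewrite lerBlDr -lerBlDl.
apply: (lb_le_inf (straighten_nonempty y)) => _ [s /= s0 <-].
rewrite lerBlDl.
apply: (le_trans (straighten_leP (x + y) (addr_ge0 t0 s0))).
have := sp.2 (x + t *: e) (y + s *: e).
by rewrite addrACA -scalerDl mulrDl; lra.
Qed.

Lemma straighten_opp : straighten p e e + straighten p e (- e) <= 0.
Proof.
have := straighten_le e; have := straighten_leP (- e) ler01.
by rewrite scale1r addNr sublinear0// mul1r; lra.
Qed.

End Straighten.

(** Being odd at [e] survives further straightening: the bound
   [q e + q (- e) <= 0] passes to every smaller functional. *)
Lemma straighten_seq p (s : seq 'cV[R]_m) : sublinear p ->
  exists q, [/\ sublinear q, (forall x, q x <= p x)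
    & forall e, e \in s -> q e + q (- e) <= 0].
Proof.
move=> sp; elim: s => [|e s [q [sq qp qs]]]; first by exists p; split.
exists (straighten q e); split; first exact: sublinear_straighten.
  by move=> x; exact: le_trans (straighten_le _ sq _) (qp x).
move=> e'; rewrite inE => /predU1P[->|e's]; first exact: straighten_opp.
exact: le_trans (lerD (straighten_le _ sq _) (straighten_le _ sq _)) (qs _ e's).
Qed.

Lemma col_sum_delta x : x = \sum_(i < m) x i 0 *: delta_mx i 0.
Proof.
rewrite {1}(matrix_sum_delta x); apply: eq_bigr => i _.
by rewrite big_ord_recl big_ord0 addr0.
Qed.

(** A sublinear functional that is odd at the vectors of the canonical basis is
   linear, so it is enough to straighten along each of these vectors. *)
Lemma sublinear_ge_linear p : sublinear p ->
  exists v, forall x, dot v x <= p x.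
Proof.
move=> sp.
pose b i : 'cV[R]_m := delta_mx i 0.
have [q [sq qp qb]] := straighten_seq [seq b i | i <- enum 'I_m] sp.
have {}qb i : q (- b i) <= - q (b i).
  have /qb : b i \in [seq b i | i <- enum 'I_m] by apply: map_f; rewrite mem_enum.
  lra.
exists (\col_i q (b i)) => x; apply: le_trans (qp x).
have qx y : q y <= dot (\col_i q (b i)) y.
  rewrite [in leLHS](col_sum_delta y) /dot.
  elim/big_ind2: _ => [|u u' w w' uu' ww'|i _]; first by rewrite sublinear0.
    by apply: (le_trans (sq.2 _ _)); exact: lerD.
  rewrite mxE mulrC; have [y0|y0] := leP 0 (y i 0); first by rewrite sublinearZ.
  rewrite -[_ *: _]opprK -scaleNr -scalerN sublinearZ//; last lra.
  have := qb i; nra.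
have := qx (- x); have := sublinear_opp x sq; rewrite dotNr; lra.
Qed.

End HahnBanach.

Section Sandwich.
Context {R : realType} {m : nat}.
Variables (E : 'cV[R]_m -> R -> Prop) (N : R).
Hypothesis E_convex : forall x y s t a, E x s -> E y t -> 0 <= a <= 1 ->
  E (a *: x + (1 - a) *: y) (a * s + (1 - a) * t).
Hypothesis E_nonempty : exists x s, E x s.
Hypothesis N_ge0 : 0 <= N.
Hypothesis E_ge : forall x s, E x s -> - (N * enorm x) <= s.

(* The infimum of S x, as a function of x, is the lower boundary of the convex
   cone that E and the epigraph of N |.| generate: it is sublinear and below
   both. *)
Let S x := [set r : R | exists t w s,
  [/\ 0 <= t, E w s & r = t * s + N * enorm (x - t *: w)]].

Let S_nonempty x : S x !=set0.
Proof.
by have [w [s ws]] := E_nonempty; exists (0 * s + N * enorm (x - 0 *: w)), 0, w, s.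
Qed.

Let S_lb x : lbound (S x) (- (N * enorm x)).
Proof.
move=> _ [t [w [s [t0 ws ->]]]].
have h : enorm (t *: w) <= enorm x + enorm (x - t *: w).
  have := ler_enormD x (- (x - t *: w)).
  by rewrite enormN opprB addrCA subrr addr0.
rewrite enormZ ger0_norm// in h.
have := ler_wpM2l t0 (E_ge ws); have := ler_wpM2l N_ge0 h; nra.
Qed.

Let S_le x t w s : 0 <= t -> E w s -> inf (S x) <= t * s + N * enorm (x - t *: w).
Proof.
move=> t0 ws; apply: ge_inf; last by exists t, w, s.
by exists (- (N * enorm x)); exact: S_lb.
Qed.

Let sublinear_inf : sublinear (fun x => inf (S x)).
Proof.
split=> [a x a0|x y].
  rewrite -ler_pdivrMl//; apply: (lb_le_inf (S_nonempty x)).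
  move=> _ [t [w [s [t0 ws ->]]]]; rewrite ler_pdivrMl//.
  apply: (le_trans (S_le (a *: x) (mulr_ge0 (ltW a0) t0) ws)).
  by rewrite -scalerA -scalerBr enormZ ger0_norm ?(ltW a0)//; lra.
rewrite -lerBlDr; apply: (lb_le_inf (S_nonempty x)).
move=> _ [t1 [w1 [s1 [t10 ws1 ->]]]].
rewrite lerBlDr -lerBlDl; apply: (lb_le_inf (S_nonempty y)).
move=> _ [t2 [w2 [s2 [t20 ws2 ->]]]]; rewrite lerBlDl.
set t := t1 + t2.
have tri w : w = t1 *: w1 + t2 *: w2 ->
    enorm (x + y - w) <= enorm (x - t1 *: w1) + enorm (y - t2 *: w2).
  by move=> ->; rewrite opprD addrACA; exact: ler_enormD.
have [t0|t_neq0] := eqVneq t 0.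
  have t1E : t1 = 0 by rewrite /t in t0; lra.
  have t2E : t2 = 0 by rewrite /t in t0; lra.
  apply: (le_trans (S_le (x + y) (lexx 0) ws1)).
  have := ler_wpM2l N_ge0 (tri (0 *: w1) _).
  by rewrite t1E t2E !scale0r addr0 => /(_ erefl); lra.
have t_gt0 : 0 < t by rewrite lt_neqAle eq_sym t_neq0 addr_ge0.
have a01 : 0 <= t1 / t <= 1.
  by rewrite divr_ge0 ?(ltW t_gt0)//= ler_pdivrMr// mul1r lerDl.
apply: (le_trans (S_le (x + y) (ltW t_gt0) (E_convex ws1 ws2 a01))).
have a' : t * (1 - t1 / t) = t2 by rewrite mulrBr mulr1 mulrC divfK// /t; ring.
have a'' : t * (t1 / t) = t1 by rewrite mulrC divfK.
rewrite mulrDr (mulrA t _ s1) (mulrA t _ s2) a' a''.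
have := ler_wpM2l N_ge0 (tri (t *: ((t1 / t) *: w1 + (1 - t1 / t) *: w2)) _).
by rewrite scalerDr !scalerA a' a'' => /(_ erefl); lra.
Qed.

(** A convex epigraph that lies above the concave function [- N |.|] lies above
   a linear form of norm at most [N]: the largest sublinear functional below
   both the epigraph and [N |.|] is finite, and dominates a linear form. *)
Lemma sandwich : exists2 v, enorm v <= N & forall x s, E x s -> dot v x <= s.
Proof.
have [v vp] := sublinear_ge_linear sublinear_inf; exists v; last first.
  move=> x s xs; apply: (le_trans (vp x)); have := S_le x ler01 xs.
  by rewrite scale1r subrr enorm0 mulr0 addr0 mul1r.
have [v0|v_neq0] := eqVneq (enorm v) 0; first by rewrite v0.
have v_gt0 : 0 < enorm v by rewrite lt_neqAle eq_sym v_neq0 enorm_ge0.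
rewrite -(ler_pM2r v_gt0) -expr2 enorm2; apply: (le_trans (vp v)).
have [w [s ws]] := E_nonempty; have := S_le v (lexx 0) ws.
by rewrite scale0r subr0 mul0r add0r.
Qed.

End Sandwich.


(** * Convex functions and their conjugates *)

Section Conjugate.
Context {R : realType} {m : nat}.
Implicit Types (h : 'cV[R]_m -> \bar R) (u v w x y z : 'cV[R]_m).
Local Open Scope ereal_scope.

(** Convexity of the epigraph, which speaks of real numbers only. *)
Definition epi_convex h : Prop := forall x y (s t a : R),
  h x <= s%:E -> h y <= t%:E -> (0 <= a <= 1)%R ->
  h (a *: x + (1 - a) *: y)%R <= (a * s + (1 - a) * t)%R%:E.

Lemma convex_efun_epi h : convex_efun h -> epi_convex h.
Proof.
move=> hc x y s t a hs ht a01; have /andP[a0 a1] := a01.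
apply: (le_trans (hc x y a a01)).
by rewrite [leRHS]EFinD !EFinM leeD// lee_wpmul2l// lee_fin ?subr_ge0.
Qed.

Lemma domP h x : (forall x, h x != -oo) -> dom h x -> exists s : R, h x = s%:E.
Proof.
by move=> /(_ x); rewrite /dom/=; case: (h x) => // r _ _; exists r.
Qed.

Lemma fconj_leP h u (c : R) : (forall x, h x != -oo) ->
  fconj h u <= c%:E <-> forall x (s : R), h x = s%:E -> (dot u x - c <= s)%R.
Proof.
move=> hN; split=> [uc x s xs|H].
  have : (dot u x)%:E - h x <= c%:E.
    by apply: le_trans uc; apply: ereal_sup_ubound; exists x.
  by rewrite xs -EFinB lee_fin; lra.
apply: ge_ereal_sup => _ [x _ <-].
case hx : (h x) => [s||]; last by have := hN x; rewrite hx.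
  by rewrite -EFinB lee_fin; have := H _ _ hx; lra.
by rewrite addeNy leNye.
Qed.

Lemma fconj_neqNy h u : (forall x, h x != -oo) -> dom h !=set0 ->
  fconj h u != -oo.
Proof.
move=> hN [x /(domP hN)[s xs]]; rewrite -ltNye.
apply: (@lt_le_trans _ _ ((dot u x)%:E - h x)); first by rewrite xs -EFinB ltNyr.
by apply: ereal_sup_ubound; exists x.
Qed.

Lemma fconj_young h u x (s c : R) : (forall x, h x != -oo) ->
  h x = s%:E -> fconj h u = c%:E -> (dot u x <= s + c)%R.
Proof.
move=> hN xs uc; have /(fconj_leP _ _ hN)/(_ _ _ xs) : fconj h u <= c%:E by rewrite uc.
by lra.
Qed.

Lemma fconj_epi_convex h : (forall x, h x != -oo) -> epi_convex (fconj h).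
Proof.
move=> hN u v s t a /(fconj_leP _ _ hN) us /(fconj_leP _ _ hN) vt /andP[a0 a1].
apply/(fconj_leP _ _ hN) => x r xr; have := us _ _ xr; have := vt _ _ xr.
rewrite dotDl !dotZl => h1 h2.
have a1' : (0 <= 1 - a)%R by lra.
have := ler_wpM2l a0 h2; have := ler_wpM2l a1' h1; lra.
Qed.

(** The epigraph, translated so that [(x0, c)] becomes the origin, satisfies the
   hypotheses of [sandwich]. *)
Lemma affine_minorant h x0 (c N : R) :
  epi_convex h -> proper_efun h -> (0 <= N)%R ->
  (forall y (s : R), h y <= s%:E -> (c - N * enorm (y - x0) <= s)%R) ->
  exists2 v, (enorm v <= N)%R &
    forall y (s : R), h y = s%:E -> (c + dot v (y - x0) <= s)%R.
Proof.
move=> hc [hN [z /(domP hN)[r zr]]] N0 H.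
have [||//||v vN vE] := @sandwich _ _
    (fun w s => h (w + x0)%R <= (s + c)%R%:E) N.
- move=> x y s t a xs yt a01; have := hc _ _ _ _ _ xs yt a01.
  have -> : (a *: (x + x0) + (1 - a) *: (y + x0) = a *: x + (1 - a) *: y + x0)%R.
    by apply/matrixP => i j; rewrite !mxE; ring.
  by congr (_ <= _%:E); ring.
- by exists (z - x0)%R, (r - c)%R; rewrite !subrK zr.
- by move=> y s /H; rewrite addrK; lra.
exists v => // y s ys.
by have := vE (y - x0)%R (s - c)%R; rewrite !subrK ys lexx => /(_ isT); lra.
Qed.

(** Lower semicontinuity bounds [h] below on a small sphere around a point [x0]
   of its domain; convexity on the segment from [x0] through that sphere then
   bounds [h] below at every farther point, by a multiple of the distance. *)
Lemma lipschitz_minorant h x0 (s0 : R) :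
  proper_closed_convex h -> h x0 = s0%:E ->
  exists2 N : R, (0 <= N)%R & forall y (s : R), h y <= s%:E ->
    (s0 - 1 - N * enorm (y - x0) <= s)%R.
Proof.
move=> [[hN _] lsc /convex_efun_epi hc] hx0.
have [V /nbhs_enorm_ball[e e0 eV] hV] : exists2 V, nbhs x0 V &
    forall y, V y -> (s0 - 1)%:E < h y.
  by apply: lsc; rewrite hx0 lte_fin; lra.
have near y (s : R) : (enorm (y - x0) < e)%R -> h y <= s%:E -> (s0 - 1 < s)%R.
  by move=> /eV/hV h1 h2; rewrite -lte_fin; exact: lt_le_trans h1 h2.
exists (2 / e)%R => [|y s ys]; first by rewrite divr_ge0// ltW.
set d := enorm _; have [de|de] := ltP d e.
  have := near _ _ de ys.
  have : (0 <= 2 / e * d)%R by rewrite mulr_ge0 ?enorm_ge0 ?divr_ge0// ltW.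
  lra.
have d0 : (0 < d)%R by lra.
pose t : R := (e / (2 * d))%R.
have tE : (t * d = e / 2)%R by rewrite /t invfM mulrA divfK// gt_eqF.
have t0 : (0 < t)%R by rewrite divr_gt0// mulr_gt0.
have t1 : (t <= 1)%R by rewrite ler_pdivrMr; lra.
have hx0' : h x0 <= s0%:E by rewrite hx0.
have t01 : (0 <= t <= 1)%R by rewrite ltW.
have /near := hc _ _ _ _ _ ys hx0' t01.
have -> : (t *: y + (1 - t) *: x0 - x0 = t *: (y - x0) :> 'cV[R]_m)%R.
  by apply/matrixP => i j; rewrite !mxE; ring.
rewrite enormZ (ger0_norm (ltW t0)) -/d tE => /(_ ltac:(lra)) h1.
have tN : (t * (2 / e * d) = 1)%R.
  by rewrite mulrCA tE mulrA divfK ?mulfV// gt_eqF.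
rewrite -(ler_pM2l t0); lra.
Qed.

Lemma fconj_proper h : proper_closed_convex h -> proper_efun (fconj h).
Proof.
move=> hP; have [[hN hD] _ /convex_efun_epi hc] := hP.
split=> [u|]; first exact: fconj_neqNy.
have [x0 /(domP hN)[s0 x0s0]] := hD.
have [N N0 H] := lipschitz_minorant hP x0s0.
have [v _ vh] := affine_minorant hc (conj hN hD) N0 H.
exists v; rewrite /dom /=.
apply: (@le_lt_trans _ _ (dot v x0 - (s0 - 1))%:E); last exact: ltry.
apply/(fconj_leP _ _ hN) => x s /vh; rewrite dotBr; lra.
Qed.

(** The Fenchel-Moreau theorem, in its nontrivial direction. For [c < h x], the
   function [h] lies above a steep enough downward cone with apex [(x, c)]: near
   [x] by lower semicontinuity, away from [x] because [h] decreases at most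
   linearly. *)
Lemma le_biconj h x : proper_closed_convex h -> h x <= fconj (fconj h) x.
Proof.
move=> hP; have [[hN hD] lsc /convex_efun_epi hc] := hP.
suff H (c : R) : c%:E < h x -> c%:E <= fconj (fconj h) x.
  case hx : (h x) => [r||]; last by have := hN x; rewrite hx.
    apply/lee_subgt0Pr => e e0; rewrite -EFinB; apply: H.
    by rewrite hx lte_fin; lra.
  rewrite leye_eq; apply/eqP/eqyP => e e0.
  by apply: H; rewrite hx ltry.
move=> cx.
have [V /nbhs_enorm_ball[e e0 eV] hV] := lsc _ _ cx.
have [x0 /(domP hN)[s0 x0s0]] := hD.
have [N N0 HN] := lipschitz_minorant hP x0s0.
pose b := (c - (s0 - 1 - N * enorm (x - x0)))%R.
pose M := (N + `|b| / e)%R.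
have M0 : (0 <= M)%R by rewrite addr_ge0// divr_ge0// ltW.
have [y s ys|v _ vh] := affine_minorant hc (conj hN hD) M0 (c := c) (x0 := x).
  have d0 := enorm_ge0 (y - x); have [de|de] := ltP (enorm (y - x)) e.
    have : (c < s)%R by rewrite -lte_fin; exact: lt_le_trans (hV _ (eV _ de)) ys.
    have := mulr_ge0 M0 d0; lra.
  have tri : (enorm (y - x0) <= enorm (y - x) + enorm (x - x0))%R.
    by have := ler_enormD (y - x) (x - x0); rewrite addrA subrK.
  have := HN _ _ ys; have := ler_wpM2l N0 tri.
  have : (`|b| <= `|b| / e * enorm (y - x))%R.
    by rewrite -mulrA ler_peMr// ler_pdivlMl// mulr1.
  have := ler_norm b; rewrite /M /b; lra.
have vc : fconj h v <= (dot v x - c)%:E.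
  by apply/(fconj_leP _ _ hN) => y s /vh; rewrite dotBr; lra.
apply: (@le_trans _ _ ((dot x v)%:E - fconj h v)); last first.
  by apply: ereal_sup_ubound; exists v.
have := fconj_neqNy v hN hD; move: vc.
case: (fconj h v) => // r; rewrite -EFinB !lee_fin dotC => *; lra.
Qed.

(** Perturbing a minimizer [x] towards [w] by a fraction [t], the quadratic
   penalty contributes to first order [t * dot (x - z) (w - x)]. *)
Lemma prox_subgradient h (l : R) z x : epi_convex h -> proper_efun h ->
  (0 < l)%R -> prox (fun y => l%:E * h y) z x ->
  exists2 a : R, h x = a%:E &
    forall w (b : R), h w = b%:E -> (a + l^-1 * dot (z - x) (w - x) <= b)%R.
Proof.
move=> hc [hN hD] l0 xmin.
have [a xa] : exists a : R, h x = a%:E.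
  apply: (domP hN); rewrite /dom/=.
  have [w0 /(domP hN)[b0 w0b0]] := hD.
  have := xmin w0; rewrite w0b0; case: (h x) (hN x) => [r||//] _; first by rewrite ltry.
  by rewrite gt0_muley ?lte_fin// addye// -EFinM -EFinD leye_eq.
exists a => // w b wb; have [//|H] := leP (a + _)%R b; exfalso.
pose c := (l * (a - b) + dot (z - x) (w - x))%R.
have c0 : (0 < c)%R.
  rewrite -subr_gt0 -(pmulr_rgt0 _ l0) mulrBr mulrDr mulrA mulfV ?gt_eqF// mul1r in H.
  by rewrite /c; lra.
set D := dot (w - x) (w - x); have D0 : (0 <= D)%R by exact: dot_ge0.
pose t := (c / (c + D))%R.
have cD : (0 < c + D)%R by lra.
have t0 : (0 < t)%R by exact: divr_gt0.
have t1 : (t <= 1)%R by rewrite ler_pdivrMr// mul1r lerDl.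
have tE : (t * (c + D) = c)%R by rewrite divfK// gt_eqF.
have t01 : (0 <= t <= 1)%R by rewrite ltW.
have wb' : h w <= b%:E by rewrite wb.
have xa' : h x <= a%:E by rewrite xa.
have h1 := hc _ _ _ _ _ wb' xa' t01.
have /(le_trans (xmin _)) : l%:E * h (t *: w + (1 - t) *: x)%R +
    (2^-1 * enorm (t *: w + (1 - t) *: x - z) ^+ 2)%:E <=
    l%:E * (t * b + (1 - t) * a)%:E +
    (2^-1 * enorm (t *: w + (1 - t) *: x - z) ^+ 2)%:E.
  by rewrite leeD2r// lee_wpmul2l// lee_fin ltW.
rewrite xa -!EFinM -!EFinD lee_fin !enorm2.
have -> : (t *: w + (1 - t) *: x - z = t *: (w - x) - (z - x) :> 'cV[R]_m)%R.
  by apply/matrixP => i j; rewrite !mxE; ring.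
have -> : (x - z = - (z - x) :> 'cV[R]_m)%R by rewrite opprB.
move: c0 tE; rewrite /c; set q := (z - x)%R; set d := (w - x)%R => c0 tE.
have DE : dot d d = D by [].
clearbody q d D.
rewrite !(dotBl, dotBr, dotNl, dotNr, dotZl, dotZr) (dotC d q) DE => h2.
have : (0 <= t * ((l * (b - a) - dot q d) + t * (D / 2)))%R by lra.
rewrite pmulr_rge0// => h3.
have tD : (t * (D / 2) < l * (a - b) + dot q d)%R by nra.
lra.
Qed.

End Conjugate.


Section Subgradients.
Context {R : realType} {m : nat}.
Local Open Scope ereal_scope.

(** The Lipschitz bound says that [h] lies above the downward cone of slope [M]
   with apex [(z, h z)]. *)
Lemma lipschitz_subgradient (h : 'cV[R]_m -> \bar R) z (a M : R) :
  epi_convex h -> proper_efun h -> (0 <= M)%R -> lipschitz_on_dom M h ->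
  h z = a%:E ->
  exists2 v, (enorm v <= M)%R & fconj h v <= (dot v z - a)%:E.
Proof.
move=> hc hP M0 hL za; have hN := hP.1.
have zdom : dom h z by rewrite /dom/= za ltry.
have [y s ys|v vM vh] := affine_minorant hc hP M0 (c := a) (x0 := z).
  have ydom : dom h y by rewrite /dom/= (le_lt_trans ys)// ltry.
  have [b yb] := domP hN ydom.
  have := hL _ _ zdom ydom; move: ys; rewrite za yb -EFinB abse_EFin !lee_fin enormB.
  by have := ler_norm (a - b)%R; lra.
by exists v => //; apply/fconj_leP => // x s /vh; rewrite dotBr; lra.
Qed.

End Subgradients.

(** * Relative interior and strong duality *)

Section RelativeInterior.
Context {R : realType} {m : nat}.
Implicit Types (C : set 'cV[R]_m).

(** Normalizing the weights would fail when they are all zero; the scaled form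
   covers this case too. *)
Lemma convex_cone_sum C (I : Type) (r : seq I) (l : I -> R) (c : I -> 'cV[R]_m) :
  (forall x y a, C x -> C y -> 0 <= a <= 1 -> C (a *: x + (1 - a) *: y)) ->
  C !=set0 -> (forall i, 0 <= l i) -> (forall i, C (c i)) ->
  exists2 x, C x & \sum_(i <- r) l i *: c i = (\sum_(i <- r) l i) *: x.
Proof.
move=> Cc [x0 Cx0] l0 Cc'; elim: r => [|i r [x Cx IH]].
  by exists x0 => //; rewrite !big_nil scale0r.
rewrite !big_cons IH; set L := \sum_(j <- r) l j.
have L0 : 0 <= L by apply: sumr_ge0.
have [lL|lL] := eqVneq (l i + L) 0.
  have l0' : l i = 0 by have := l0 i; lra.
  have L0' : L = 0 by lra.
  by exists x => //; rewrite l0' L0' addr0 !scale0r addr0.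
have lL0 : 0 < l i + L by rewrite lt_neqAle eq_sym lL addr_ge0.
exists ((l i / (l i + L)) *: c i + (1 - l i / (l i + L)) *: x).
  apply: Cc => //; rewrite divr_ge0 ?(ltW lL0)//= ler_pdivrMr// mul1r lerDl//.
have -> : 1 - l i / (l i + L) = L / (l i + L) by field.
by rewrite scalerDr !scalerA; congr (_ *: _ + _ *: _); field.
Qed.

(** A family of points of [C] of maximal rank spans the affine hull of [C]; the
   coordinates are a fixed linear function of the point, hence the bound. *)
Lemma aff_coordinates C : C 0 ->
  exists (d : nat) (b : 'I_d -> 'cV[R]_m) (N : R),
  [/\ forall i, C (b i), 0 <= N & forall w, aff C w -> exists c : 'I_d -> R,
    w = \sum_i c i *: b i /\ forall i, `|c i| <= N * enorm w].
Proof.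
move=> C0.
pose P (r : nat) := exists (d : nat) (A : 'M[R]_(d, m)),
  (forall i, C (row i A)^T) /\ \rank A = r.
have exP : exists r, `[< P r >].
  exists 0%N; apply/asboolP; exists 0%N, 0; split; last by rewrite mxrank0.
  by case.
have leP r : `[< P r >] -> (r <= m)%N.
  by move=> /asboolP[d [A [_ <-]]]; exact: rank_leq_col.
have [r /asboolP[d [A [CA Ar]]] rmax] := ex_maxnP exP leP.
have subA w : aff C w -> (w^T <= A)%MS.
  move=> [k [l [c [Cc _ ->]]]].
  rewrite linear_sum/=; apply: summx_sub => i _; rewrite linearZ/=.
  apply: scalemx_sub.
  have : `[< P (\rank (A + (c i)^T)%MS) >].
    apply/asboolP; exists (d + 1)%N, (col_mx A (c i)^T); split; last first.
      by rewrite addsmxE.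
    move=> j; case: (split_ordP j) => j' ->.
      by rewrite rowKu; exact: CA.
    rewrite rowKd; have -> : (row j' (c i)^T)^T = c i; last exact: Cc.
    by apply/matrixP => a b; rewrite !mxE !ord1.
  move=> /rmax; rewrite -Ar => le_rk.
  have [le_rk' eq_rk] := mxrank_leqif_sup (addsmxSl A (c i)^T).
  have : (A + (c i)^T <= A)%MS by rewrite -eq_rk eqn_leq le_rk' le_rk.
  by rewrite addsmx_sub => /andP[].
exists d, (fun i => (row i A)^T), (\sum_i \sum_j `|pinvmx A j i|); split => //.
  by apply: sumr_ge0 => i _; apply: sumr_ge0 => j _; exact: normr_ge0.
move=> w Cw; exists (fun i => (w^T *m pinvmx A) 0 i); split.
  apply: trmx_inj; rewrite -[LHS](mulmxKpV (subA _ Cw)) linear_sum/=.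
  apply/matrixP => a b; rewrite !mxE summxE ord1.
  by apply: eq_bigr => i _; rewrite !mxE.
move=> i; rewrite mxE; apply: (le_trans (ler_norm_sum _ _ _)).
rewrite (bigD1 i)//= mulrDl mulr_suml; apply: ler_wpDr.
  apply: mulr_ge0; last exact: enorm_ge0.
  by apply: sumr_ge0 => k _; apply: sumr_ge0 => j _; exact: normr_ge0.
apply: ler_sum => j _; rewrite normrM mulrC [w^T 0 j]mxE.
by rewrite ler_wpM2l ?normr_ge0 ?ler_abs_enorm.
Qed.

(** Write [- w] as a positive combination of the finitely many points
   [+- dl *: b i], on which the values in [E] are bounded by a constant [M]. As
   [0] is then a convex combination of [w] and of a point where [E] has a value
   below [M], a value of [E] far below [c] at [w] would give one below [c] at
   [0]. The weights are controlled by the coordinates of [w]. *)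
Lemma ri_linear_minorant (E : 'cV[R]_m -> R -> Prop) (c : R) :
  (forall x y s t a, E x s -> E y t -> 0 <= a <= 1 ->
    E (a *: x + (1 - a) *: y) (a * s + (1 - a) * t)) ->
  ri [set w | exists s, E w s] 0 ->
  (forall s, E 0 s -> c <= s) ->
  exists2 N, 0 <= N & forall w s, E w s -> c - N * enorm w <= s.
Proof.
move=> Ec [C0 [e e0 Ce]] cE; set C := [set w | _] in C0 Ce.
have [d [b [N [Cb N0 coord]]]] := aff_coordinates C0.
pose B := 1 + \sum_i enorm (b i).
have B1 : 1 <= B by rewrite lerDl sumr_ge0// => i _; exact: enorm_ge0.
pose dl := e / (2 * B).
have dl0 : 0 < dl by rewrite divr_gt0//; lra.
have [s0 Es0] := C0.
have Cdb (i : 'I_d) a : `|a| = dl -> C (a *: b i).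
  move=> adl; apply: Ce.
    exists 2%N, (fun j : 'I_2 => if j == 0 then a else 1 - a).
    exists (fun j : 'I_2 => if j == 0 then b i else 0); split.
    - by move=> j; case: ifP.
    - by rewrite !big_ord_recl big_ord0/=; ring.
    - by rewrite !big_ord_recl big_ord0/= scaler0 !addr0.
  rewrite subr0 enormZ adl.
  have biB : enorm (b i) <= B.
    rewrite /B (bigD1 i)//= addrCA lerDl; apply: addr_ge0 => //.
    by apply: sumr_ge0 => j _; exact: enorm_ge0.
  apply: (le_lt_trans (ler_wpM2l (ltW dl0) biB)).
  rewrite (_ : dl * B = e / 2); last by rewrite /dl; field; lra.
  lra.
have /choice[sp Esp] (i : 'I_d) : exists s, E (dl *: b i) s.
  by apply: Cdb; rewrite ger0_norm ?ltW.
have /choice[sm Esm] (i : 'I_d) : exists s, E (- dl *: b i) s.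
  by apply: Cdb; rewrite normrN ger0_norm ?ltW.
pose M := `|s0| + \sum_i (`|sp i| + `|sm i|).
have M_ge (i : 'I_d) : `|sp i| + `|sm i| <= M.
  rewrite /M (bigD1 i)//= addrCA lerDl; apply: addr_ge0 => //.
  by apply: sumr_ge0 => j _; exact: addr_ge0.
have s0M : s0 <= M.
  by rewrite (le_trans (ler_norm _))// lerDl; apply: sumr_ge0 => j _; exact: addr_ge0.
pose A := [set w | exists2 s, s <= M & E w s].
have Ac x y a : A x -> A y -> 0 <= a <= 1 -> A (a *: x + (1 - a) *: y).
  move=> [s sM xs] [t tM yt] a01; exists (a * s + (1 - a) * t); last exact: Ec.
  by have /andP[a0 a1] := a01; nra.
have A_nonempty : A !=set0 by exists 0, s0.
have cM : c <= M by exact: le_trans (cE _ Es0) s0M.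
exists (d%:R * N / dl * (M - c)).
  by rewrite mulr_ge0 ?subr_ge0// divr_ge0 ?(ltW dl0)// mulr_ge0.
move=> w s ws.
have Cw : aff C w.
  exists 1%N, (fun=> 1), (fun=> w); split; first by exists s.
    by rewrite big_ord_recl big_ord0 addr0.
  by rewrite big_ord_recl big_ord0 addr0 scale1r.
have [a [wE aN]] := coord _ Cw.
pose x (i : 'I_d) := (if 0 <= a i then - dl else dl) *: b i.
have Ax i : A (x i).
  have := M_ge i; rewrite /x; case: ifP => _ Mi.
    exists (sm i); last exact: Esm.
    by have := normr_ge0 (sp i); have := ler_norm (sm i); lra.
  exists (sp i); last exact: Esp.
  by have := normr_ge0 (sm i); have := ler_norm (sp i); lra.
have l0 i : 0 <= `|a i| / dl by rewrite divr_ge0// ltW.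
have [z [t tM zt] zE] := convex_cone_sum (index_enum 'I_d) Ac A_nonempty l0 Ax.
set L : R := \sum_(i <- _) (`|a i| / dl) in zE.
have L0 : 0 <= L by apply: sumr_ge0.
have zw : L *: z = - w.
  rewrite -zE [in RHS]wE -sumrN; apply: eq_bigr => i _; rewrite /x.
  have [ai|ai] := leP 0 (a i).
    by rewrite ger0_norm// scalerA mulrN divfK ?gt_eqF// scaleNr.
  by rewrite ltr0_norm// scalerA divfK ?gt_eqF// scaleNr.
have LN : L <= d%:R * N / dl * enorm w.
  apply: (@le_trans _ _ (\sum_(i < d) N * enorm w / dl)).
    by apply: ler_sum => i _; rewrite ler_pM2r ?invr_gt0.
  by rewrite sumr_const card_ord -mulr_natl le_eqVlt; apply/orP; left; apply/eqP; ring.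
have L1 : 0 < 1 + L by lra.
have k01 : 0 <= (1 + L)^-1 <= 1 by rewrite invr_ge0 ltW//= invf_le1//; lra.
have := Ec _ _ _ _ _ ws zt k01.
have kE : 1 - (1 + L)^-1 = (1 + L)^-1 * L by field; lra.
rewrite kE -scalerA zw -scalerDr subrr scaler0 => /cE.
rewrite -[_ * L * t]mulrA -mulrDr ler_pdivlMl// => H.
have cM0 : 0 <= M - c by rewrite subr_ge0.
have := ler_wpM2r cM0 LN; have := ler_wpM2l L0 tM.
lra.
Qed.

End RelativeInterior.

Section Duality.
Context {R : realType} {n p : nat}.
Variables (f : 'cV[R]_p -> \bar R) (g : 'cV[R]_n -> \bar R) (K : 'M[R]_(n, p)).
Hypotheses (fP : proper_efun f) (fc : epi_convex f).
Hypotheses (gP : proper_efun g) (gc : epi_convex g).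
Local Open Scope ereal_scope.

(** The dual solution is a subgradient at [0] of the value function
   [w |-> inf_v f v + g (K v + w)], whose domain is [dom g - K dom f]. *)
Lemma strong_duality x : domain_qualification f g K -> primal_sol f g K x ->
  exists2 c : R, primal_obj f g K x = c%:E &
    exists y, dual_obj f g K y <= (- c)%:E.
Proof.
move=> qual xmin; have [fN fD] := fP; have [gN gD] := gP.
pose E (w : 'cV[R]_n) (s : R) := exists v u (a b : R),
  [/\ f v <= a%:E, g u <= b%:E, w = (u - K *m v)%R & s = (a + b)%R].
have EC : [set w | exists s, E w s] =
    [set (u - K *m v)%R | u in dom g & v in dom f].
  apply/seteqP; split=> [w [s [v [u [a [b [va ub -> _]]]]]]|].
    exists u; first by rewrite /dom/= (le_lt_trans ub)// ltry.
    by exists v => //; rewrite /dom/= (le_lt_trans va)// ltry.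
  move=> _ [u /(domP gN)[b ub] [v /(domP fN)[a va] <-]].
  by exists (a + b)%R, v, u, a, b; split; rewrite ?va ?ub.
have Ec w w' s s' (a : R) : E w s -> E w' s' -> (0 <= a <= 1)%R ->
    E (a *: w + (1 - a) *: w')%R (a * s + (1 - a) * s')%R.
  move=> [v [u [r [t [vr ut -> ->]]]]] [v' [u' [r' [t' [vr' ut' -> ->]]]]] a01.
  exists (a *: v + (1 - a) *: v')%R, (a *: u + (1 - a) *: u')%R,
    (a * r + (1 - a) * r')%R, (a * t + (1 - a) * t')%R; split.
  - exact: fc.
  - exact: gc.
  - rewrite !scalerBr mulmxDr -!scalemxAr.
    by apply/matrixP => i j; rewrite !mxE; ring.
  - by ring.
have E0 v (a b : R) : f v <= a%:E -> g (K *m v) <= b%:E ->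
    primal_obj f g K x <= (a + b)%:E.
  by move=> va ub; rewrite (le_trans (xmin v))// EFinD leeD.
have ri0 : ri [set w | exists s, E w s] 0%R by rewrite EC.
have E0' s : E 0%R s -> primal_obj f g K x <= s%:E.
  move=> [v [u [a [b [va ub /esym/eqP + ->]]]]]; rewrite subr_eq0 => /eqP uE.
  by apply: (E0 v) => //; rewrite -uE.
have [c xc] : exists c : R, primal_obj f g K x = c%:E.
  have [s /E0'] := ri0.1; rewrite /primal_obj; move: (fN x) (gN (K *m x)).
  by case: (f x) => [r||]//; case: (g _) => [t||]//= _ _ _; exists (r + t)%R.
exists c => //.
have [|N N0 EN] := ri_linear_minorant Ec ri0 (c := c).
  by move=> s /E0'; rewrite xc lee_fin.
have [||//||y _ Ey] := @sandwich _ _ (fun w s => E w (s + c)%R) N.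
- move=> w w' s s' a ws ws' a01; have := Ec _ _ _ _ _ ws ws' a01.
  by congr E; ring.
- by have [s Es] := ri0.1; exists 0%R, (s - c)%R; rewrite subrK.
- by move=> w s /EN; lra.
have Eyuv v u (a b : R) : f v = a%:E -> g u = b%:E ->
    (dot y u - dot y (K *m v) + c <= a + b)%R.
  move=> va ub; have := Ey (u - K *m v)%R (a + b - c)%R.
  rewrite dotBr subrK => H.
  have {}H : (dot y u - dot y (K *m v) <= a + b - c)%R.
    by apply: H; exists v, u, a, b; split; rewrite ?va ?ub.
  lra.
have dotK v : dot (- (K^T *m y))%R v = (- dot y (K *m v))%R.
  by rewrite dotNl dotC -dot_trmx dotC.
exists y; rewrite /dual_obj.
have [u0 /(domP gN)[b0 ub0]] := gD.
have : fconj f (- (K^T *m y))%R <= (b0 - dot y u0 - c)%:E.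
  apply/(fconj_leP _ _ fN) => v a va; rewrite dotK.
  have := Eyuv _ _ _ _ va ub0; lra.
have := fconj_neqNy (- (K^T *m y))%R fN fD.
case fA : (fconj f _) => [A||]// _ _.
have gA : fconj g y <= (- c - A)%:E.
  apply/(fconj_leP _ _ gN) => u b ub.
  have : fconj f (- (K^T *m y))%R <= (b - dot y u - c)%:E.
    apply/(fconj_leP _ _ fN) => v a va; rewrite dotK.
    have := Eyuv _ _ _ _ va ub; lra.
  by rewrite fA lee_fin; lra.
apply: (le_trans (leeD2l _ gA)); rewrite -EFinD lee_fin; lra.
Qed.

End Duality.


(** * The energy of the algorithm *)

Section EnergyStep.
Context {R : realType} {n p : nat}.
Variables (K : 'M[R]_(n, p)) (rho0 gamma : R).
Hypotheses (rho0_gt0 : 0 < rho0) (gamma01 : 0 < gamma < 1).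

(** After expansion, everything cancels except the quadratic form
   [rho0 <K d, q> + gamma rho0 / 2 |q|^2 + rho0 |K|^2 / (2 gamma) |d|^2] in
   [d = z - z'] and [q = Q' - Q], which is at least
   [rho0 / (2 gamma) |gamma q + K d|^2]. *)
Lemma energy_step (z z' u : 'cV[R]_p) (Q Q' yt yt' y' v : 'cV[R]_n) :
  let kap := rho0 * opnorm K ^+ 2 / gamma in
  let om := ((1 - gamma) * rho0)^-1 in
  yt' = yt + ((1 - gamma) * rho0) *: (Q' - Q) ->
  y' = yt + rho0 *: (Q' + K *m (z - z')) ->
  dot (Q' - Q) (v - y') - kap * dot (z - z') (u - z')
  + rho0 / 2 * (dot Q' Q' - dot Q Q)
  + kap / 2 * (dot (z' - u) (z' - u) - dot (z - u) (z - u))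
  + om / 2 * (dot (yt' - v) (yt' - v) - dot (yt - v) (yt - v)) <= 0.
Proof.
move=> kap om -> ->; have /andP[g0 g1] := gamma01.
set k1 := (1 - gamma) * rho0.
have k1_neq0 : k1 != 0 by rewrite lt0r_neq0// mulr_gt0//; lra.
have omk : om * k1 = 1 by rewrite mulVf.
pose d := z - z'; pose q := Q' - Q; pose w := K *m d.
have -> : dot (z' - u) (z' - u) - dot (z - u) (z - u)
    = 2 * dot d (u - z') - dot d d.
  by rewrite /d !(dotBl, dotBr) (dotC u z') (dotC u z) (dotC z' z); ring.
have -> : dot (yt + k1 *: (Q' - Q) - v) (yt + k1 *: (Q' - Q) - v)
    - dot (yt - v) (yt - v) = k1 * (2 * dot q (yt - v) + k1 * dot q q).
  rewrite -/q; clearbody q.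
  by rewrite !(dotBl, dotBr, dotDl, dotDr, dotZl, dotZr) (dotC v yt) (dotC yt q)
    (dotC v q); ring.
have -> : dot Q' Q' - dot Q Q = 2 * dot q Q' - dot q q.
  by rewrite /q !(dotBl, dotBr) (dotC Q' Q); ring.
have -> : dot (Q' - Q) (v - (yt + rho0 *: (Q' + K *m (z - z'))))
    = - dot q (yt - v) - rho0 * (dot q Q' + dot q w).
  rewrite -/q -/d -/w; clearbody q w.
  by rewrite !(dotBr, dotDr, dotZr); ring.
rewrite -/d mulrA [om / 2 * k1](_ : _ = 2^-1); last first.
  by rewrite mulrAC omk mul1r.
have wd : dot w w <= opnorm K ^+ 2 * dot d d.
  rewrite -!enorm2 -exprMn ler_pXn2r ?nnegrE ?mulr_ge0 ?enorm_ge0 ?opnorm_ge0//.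
  exact: enorm_mulmx_le.
clearbody w q d; have := dot_ge0 (gamma *: q + w).
rewrite !(dotDl, dotDr, dotZl, dotZr) (dotC w q) => sq.
have kd : rho0 / gamma * dot w w <= kap * dot d d.
  rewrite (_ : kap * _ = rho0 / gamma * (opnorm K ^+ 2 * dot d d)).
    by rewrite ler_pM2l// divr_gt0.
  by rewrite /kap; ring.
have sq' : 0 <= rho0 * gamma * dot q q + 2 * rho0 * dot q w + rho0 / gamma * dot w w.
  have -> : rho0 * gamma * dot q q + 2 * rho0 * dot q w + rho0 / gamma * dot w w
    = rho0 / gamma * (gamma * (gamma * dot q q) + gamma * dot q w
      + (gamma * dot q w + dot w w)) by field; lra.
  rewrite mulr_ge0 ?divr_ge0 ?(ltW g0) ?(ltW rho0_gt0)//; lra.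
rewrite /k1; lra.
Qed.

End EnergyStep.

Section Iterates.
Context {R : realType} {n p : nat}.
Variables (f : 'cV[R]_p -> \bar R) (g : 'cV[R]_n -> \bar R) (K : 'M[R]_(n, p)).
Hypotheses (f_proper : proper_efun f) (f_convex : epi_convex f).
Hypotheses (gs_proper : proper_efun (fconj g)) (gs_convex : epi_convex (fconj g)).
Hypothesis K_neq0 : K != 0.
Variables (rho0 gamma : R).
Hypotheses (rho0_gt0 : 0 < rho0) (gamma01 : 0 < gamma < 1).
Variables (x0 : 'cV[R]_p) (y0 : 'cV[R]_n).
Variables (x xh : nat -> 'cV[R]_p) (y yt yb : nat -> 'cV[R]_n).
Hypothesis alg : algorithm1 f g K rho0 1 gamma x0 y0 x xh y yt yb.

Lemma tau1E k : tau 1 k = (k.+1%:R)^-1 :> R.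
Proof.
case: k => [|k] /=; first by rewrite invr1.
by rewrite mul1r !natr1.
Qed.

Lemma rho1E k : rho rho0 1 k = rho0 * k.+1%:R.
Proof. by rewrite /rho tau1E invrK. Qed.

Let kap := rho0 * opnorm K ^+ 2 / gamma.

(* Nesterov's auxiliary sequence: x k.+1 is the mean of x k and z k.+1. *)
Let z k := k.+1%:R *: xh k - k%:R *: x k.

(* By Moreau's decomposition, the prox step for g^* at yt k + rho_k K (xh k) also
   computes r k.+1, the prox of g / rho_k at K (xh k) + yt k / rho_k, and r k.+1
   is a subgradient of g^* at y k.+1. The value r 0 only occurs with the
   factor 0. *)
Let r k := if k is j.+1 then K *m xh j - (rho0 * j.+1%:R)^-1 *: (y j.+1 - yt j)
  else 0.

(* The residual of the constraint K x = r, scaled so that yt follows it. *)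
Let Q k := k%:R *: (K *m x k - r k).

Let natS_neq0 k : k.+1%:R != 0 :> R. Proof. by rewrite pnatr_eq0. Qed.

Lemma x_recE k : k.+1%:R *: x k.+1 = k%:R *: x k + z k.+1.
Proof.
rewrite /z (alg_xh alg) !tau1E; apply/matrixP => i j; rewrite !mxE.
have := natS_neq0 k; have := natS_neq0 k.+1.
rewrite -!natr1 => a0 b0; field.
by rewrite a0 b0.
Qed.

Lemma xh_x_zE k : k.+1%:R *: (xh k - x k.+1) = z k - z k.+1.
Proof.
rewrite scalerBr x_recE /z opprD addrA; congr (_ - _).
Qed.

Lemma y_recE k : y k.+1 = yt k + rho0 *: (Q k.+1 + K *m (z k - z k.+1)).
Proof.
rewrite -xh_x_zE -scalemxAr mulmxBr /Q /r.
move: (K *m xh k) (K *m x k.+1) => a b.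
apply/matrixP => i j; rewrite !mxE; have := natS_neq0 k.
rewrite -!natr1 => a0; field.
by rewrite a0 gt_eqF.
Qed.

Lemma yt_recE k : yt k.+1 = yt k + ((1 - gamma) * rho0) *: (Q k.+1 - Q k).
Proof.
rewrite (alg_yt alg) /Defs.eta rho1E !tau1E /Q /r; case: k => [|k].
  rewrite /= mulmxBr mulmxBr invr1 subrr scale0r mulmx0 mulr0 mul0r.
  move: (K *m xh 0%N) (K *m x 1%N) => a b.
  by apply/matrixP => i j; rewrite !mxE; field; rewrite gt_eqF.
rewrite /= !mulmxBr -scalemxAr !mulmxBr.
move: (K *m xh k.+1) (K *m x k.+2) (K *m x k.+1) (K *m xh k) => a b c d.
apply/matrixP => i j; rewrite !mxE.
have := natS_neq0 k; have := natS_neq0 k.+1.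
rewrite -!natr1 => a0 b0; field.
by rewrite a0 b0 gt_eqF.
Qed.

Let F k := fine (f (x k)).
Let G k := fine (fconj g (y k)).
Let Gb k := fine (fconj g (yb k)).

Let kap_gt0 : 0 < kap.
Proof.
have /andP[g0 _] := gamma01.
by rewrite divr_gt0// mulr_gt0// exprn_gt0// opnorm_gt0.
Qed.

Let beta_inv k : (beta K rho0 1 gamma k)^-1 = kap * k.+1%:R.
Proof.
have /andP[g0 _] := gamma01; rewrite /beta rho1E /kap invf_div.
by rewrite mulrA mulrAC (mulrC (opnorm K ^+ 2)).
Qed.

Lemma prox_x k : f (x k.+1) = (F k.+1)%:E /\
  forall w b, f w = b%:E ->
    F k.+1 + dot (kap *: (z k - z k.+1) - K^T *m y k.+1) (w - x k.+1) <= b.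
Proof.
have b0 : 0 < beta K rho0 1 gamma k.
  by rewrite -invr_gt0 beta_inv mulr_gt0.
have [a xa xw] := prox_subgradient f_convex f_proper b0 (alg_x alg k).
rewrite /F xa; split=> // w b /xw; apply: le_trans; rewrite /= lerD2l -dotZl.
rewrite le_eqVlt; apply/orP; left; apply/eqP; congr (dot _ _).
rewrite -xh_x_zE scalerA -beta_inv.
rewrite [in RHS]addrAC [in RHS]scalerBr [in RHS]scalerA mulVf ?gt_eqF//.
by rewrite scale1r.
Qed.

Lemma prox_y k : fconj g (y k.+1) = (G k.+1)%:E /\
  forall w b, fconj g w = b%:E -> G k.+1 + dot (r k.+1) (w - y k.+1) <= b.
Proof.
have r0 : 0 < rho rho0 1 k by rewrite rho1E mulr_gt0.
have [a ya yw] := prox_subgradient gs_convex gs_proper r0 (alg_y alg k).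
rewrite /G ya; split=> // w b /yw; apply: le_trans; rewrite /= lerD2l -dotZl.
rewrite le_eqVlt; apply/orP; left; apply/eqP; congr (dot _ _).
rewrite /r -rho1E; move: (K *m xh k) => c.
by apply/matrixP => i j; rewrite !mxE; field; rewrite gt_eqF.
Qed.

Lemma yb_recE k : k.+1%:R *: yb k.+1 = k%:R *: yb k + y k.+1.
Proof.
rewrite (alg_yb alg) tau1E; apply/matrixP => i j; rewrite !mxE.
by have := natS_neq0 k; rewrite -!natr1 => a0; field.
Qed.

Lemma fconj_yb k : fconj g (yb k.+1) = (Gb k.+1)%:E /\
  k.+1%:R * Gb k.+1 <= k%:R * Gb k + G k.+1.
Proof.
have fin (k' : nat) b : (fconj g (yb k') <= b%:E)%E ->
    fconj g (yb k') = (Gb k')%:E /\ Gb k' <= b.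
  by rewrite /Gb; case: (fconj g _) (gs_proper.1 (yb k')) => [s||].
elim: k => [|k [IH _]].
  have yb1 : yb 1%N = y 1%N.
    by have := yb_recE 0; rewrite scale1r scale0r add0r.
  by have [y1 _] := prox_y 0; rewrite /Gb yb1 y1 mul1r mul0r add0r.
have [yk _] := prox_y k.+1.
have t01 : 0 <= 1 - (tau 1 k.+1 : R) <= 1.
  by rewrite tau1E subr_ge0 gerBl invr_ge0 ler0n invf_le1 ?ltr0n// ler1n.
have := gs_convex (x := yb k.+1) (y := y k.+2) (s := Gb k.+1) (t := G k.+2) _ _ t01.
rewrite IH yk !lexx subKr -(alg_yb alg) => /(_ isT isT)/fin[-> H]; split=> //.
rewrite -(ler_pM2l (_ : 0 < (k.+2)%:R)) ?ltr0n// in H; apply: (le_trans H).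
rewrite tau1E le_eqVlt; apply/orP; left; apply/eqP.
by have := natS_neq0 k.+1; rewrite -!natr1 => a0; field.
Qed.

Section Energy.
Variables (u : 'cV[R]_p) (v : 'cV[R]_n) (fu gv : R).
Hypotheses (fuE : f u = fu%:E) (gvE : fconj g v = gv%:E).

(* The first two terms are k times the Lagrangian gap between (x k, v) and
   (u, yb k), with - fconj g v replaced by the larger g (r k) - <r k, v>, where
   g (r k) = <r k, y k> - fconj g (y k). The term in Q k is k times the
   augmentation rho_(k-1) / 2 |K x k - r k|^2. The factor k hides the values at
   k = 0, where f (x k) may be infinite. *)
Let energy k :=
  k%:R * (F k + dot (r k) (y k) - G k + dot (K *m x k - r k) v - fu + Gb k)
  - k%:R * dot (K *m u) (yb k)
  + rho0 / 2 * dot (Q k) (Q k)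
  + kap / 2 * dot (z k - u) (z k - u)
  + ((1 - gamma) * rho0)^-1 / 2 * dot (yt k - v) (yt k - v).

(** The subgradient inequality of the prox step for [f], taken at [u] and [k]
   times at [x k], bounds [f (x k.+1)]; the [k]-fold inequality is trivial at
   [k = 0], where [f (x 0)] may be infinite. Adding the inequalities for [g^*]
   and the recursions leaves the quadratic remainder of [energy_step]. *)
Lemma energy_decr k : energy k.+1 <= energy k.
Proof.
have [_ px] := prox_x k; have [_ pyb] := fconj_yb k.
have step := energy_step rho0_gt0 gamma01 u v (yt_recE k) (y_recE k).
have hx : k.+1%:R * F k.+1
    + dot (kap *: (z k - z k.+1) - K^T *m y k.+1) (u - z k.+1)
    <= fu + k%:R * F k.
  have hk : k%:R * (F k.+1
      + dot (kap *: (z k - z k.+1) - K^T *m y k.+1) (x k - x k.+1))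
      <= k%:R * F k.
    clear pyb step; case: k px => [|k] px; first by rewrite !mul0r.
    by rewrite ler_pM2l//; apply: px; have [] := prox_x k.
  have -> : u - z k.+1 = (u - x k.+1) + k%:R *: (x k - x k.+1).
    have := x_recE k; rewrite -natr1 scalerDl scale1r scalerBr => e.
    have {}e : z k.+1 = k%:R *: x k.+1 + x k.+1 - k%:R *: x k.
      by rewrite e addrAC subrr add0r.
    rewrite e; apply/matrixP => i j; rewrite !mxE; ring.
  have := px _ _ fuE; rewrite -natr1 (dotDr (u - x k.+1)) dotZr; lra.
have hy : k%:R * (G k + dot (r k) (y k.+1 - y k)) <= k%:R * G k.+1.
  clear px pyb step hx; case: k => [|k]; first by rewrite !mul0r.
  by rewrite ler_pM2l//; have [_] := prox_y k; apply; have [] := prox_y k.+1.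
have Kz : k.+1%:R *: (K *m x k.+1) = k%:R *: (K *m x k) + K *m z k.+1.
  by rewrite !scalemxAr x_recE mulmxDr.
have rE w : k.+1%:R * dot (r k.+1) w =
    k%:R * dot (r k) w + dot (K *m z k.+1) w - dot (Q k.+1 - Q k) w.
  rewrite -!dotZl -dotDl -dotBl; congr (dot _ _).
  rewrite /Q !scalerBr Kz; move: (K *m z k.+1) (K *m x k) => a b.
  by apply/matrixP => i j; rewrite !mxE; ring.
have qE : k.+1%:R * dot (K *m x k.+1 - r k.+1) v = dot (Q k.+1) v.
  by rewrite -dotZl.
have qE' : k%:R * dot (K *m x k - r k) v = dot (Q k) v by rewrite -dotZl.
have ybE : k.+1%:R * dot (K *m u) (yb k.+1) =
    k%:R * dot (K *m u) (yb k) + dot (K *m u) (y k.+1).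
  by rewrite -!dotZr yb_recE dotDr.
have KE w : dot (K^T *m y k.+1) w = dot (K *m w) (y k.+1).
  by rewrite [RHS]dot_trmx dotC.
rewrite dotBl dotZl KE mulmxBr [dot (K *m u - _) _]dotBl in hx.
rewrite dotBr in hy.
rewrite (dotBr v) [dot _ v]dotBl in step.
have rEy := rE (y k.+1).
rewrite /energy; move: hx hy step pyb qE qE' ybE rEy; rewrite -/kap -!natr1 => *.
lra.
Qed.

(** Young's inequality at [r k.+1] and [v] compares the Lagrangian gap with the
   energy, which is at most its initial value, half the weighted distance. *)
Lemma lagrangian_gap_fin k :
  k.+1%:R * (F k.+1 + dot (K *m x k.+1) v - gv
    - (fu + dot (K *m u) (yb k.+1) - Gb k.+1))
  <= 2^-1 * weighted_dist2 K rho0 gamma (enorm (x0 - u)) (enorm (y0 - v)).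
Proof.
have /andP[g0 g1] := gamma01.
have en k' : energy k' <= energy 0%N.
  by elim: k' => // k' IH; exact: le_trans (energy_decr k') IH.
have e0 : energy 0%N =
    2^-1 * weighted_dist2 K rho0 gamma (enorm (x0 - u)) (enorm (y0 - v)).
  rewrite /energy /Q /z !mul0r !scale0r dot0l subr0 scale1r (alg_xh0 alg) (alg_yt0 alg).
  rewrite /weighted_dist2 !enorm2 /kap subr0; ring.
rewrite -e0; apply: le_trans (en k.+1); rewrite /energy.
have [_ py] := prox_y k; have := py _ _ gvE.
have om0 : 0 < (1 - gamma) * rho0 by rewrite mulr_gt0// subr_gt0.
have h1 : 0 <= rho0 / 2 * dot (Q k.+1) (Q k.+1).
  by apply: mulr_ge0; [rewrite divr_ge0// ltW|exact: dot_ge0].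
have h2 : 0 <= kap / 2 * dot (z k.+1 - u) (z k.+1 - u).
  by apply: mulr_ge0; [rewrite divr_ge0// ltW|exact: dot_ge0].
have h3 : 0 <= ((1 - gamma) * rho0)^-1 / 2 * dot (yt k.+1 - v) (yt k.+1 - v).
  by apply: mulr_ge0; [rewrite divr_ge0// invr_ge0 ltW|exact: dot_ge0].
rewrite dotBr [dot (K *m x k.+1 - _) v]dotBl.
rewrite -(ler_pM2l (_ : 0 < k.+1%:R)) ?ltr0n// => h4.
lra.
Qed.

End Energy.

End Iterates.


(** * Primal-dual bounds and rates *)

Section Bounds.
Context {R : realType} {n p : nat}.
Variables (f : 'cV[R]_p -> \bar R) (g : 'cV[R]_n -> \bar R) (K : 'M[R]_(n, p)).
Hypotheses (fN : forall x, f x != -oo%E) (gN : forall x, g x != -oo%E).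
Hypotheses (fD : dom f !=set0) (gD : dom g !=set0).
Local Open Scope ereal_scope.

Lemma lagrangian_le_primal x y : lagrangian f g K x y <= primal_obj f g K x.
Proof.
rewrite /lagrangian /primal_obj.
case fx : (f x) => [a||]; last by have := fN x; rewrite fx.
  case gKx : (g (K *m x)) => [b||]; last by have := gN (K *m x); rewrite gKx.
    have gsN := fconj_neqNy y gN gD.
    case gs : (fconj g y) gsN => [c||]// _; last by rewrite addeNy leNye.
    have := fconj_young gN gKx gs.
    by rewrite -!EFinD lee_fin dotC; lra.
  by rewrite addey// leey.
by rewrite [leRHS]addye// leey.
Qed.

Lemma dual_le_lagrangian x y : - dual_obj f g K y <= lagrangian f g K x y.
Proof.
rewrite /lagrangian /dual_obj.
have gsN := fconj_neqNy y gN gD.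
have fsN := fconj_neqNy (- (K^T *m y))%R fN fD.
case gs : (fconj g y) gsN => [c||]// _; last by rewrite addey// leNye.
case fx : (f x) => [a||]; last by have := fN x; rewrite fx.
  case fs : (fconj f _) fsN => [b||]// _; last by rewrite addye// leNye.
  have := fconj_young fN fx fs.
  rewrite dotNl dotC -dot_trmx -!EFinD -EFinN lee_fin; lra.
by rewrite !addye// leey.
Qed.

Lemma ereal_inf_argmin (T : Type) (h : T -> \bar R) x :
  (forall z, h x <= h z) -> ereal_inf (range h) = h x.
Proof.
move=> hx; apply/eqP; rewrite eq_le ereal_inf_lbound/=; last by exists x.
by apply: le_ereal_inf_tmp => _ [z _ <-].
Qed.

End Bounds.

Lemma cvg_rate_1k_bound (R : realType) (u : nat -> \bar R) (l C : R) :
  (\forall k \near \oo, (0 <= u k - l%:E <= (C / k%:R)%:E)%E) ->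
  cvg_rate_1k u l%:E.
Proof.
move=> ul; split; last first.
  exists C; near=> k; have /andP[h1 h2] : (0 <= u k - l%:E <= (C / k%:R)%:E)%E by near: k.
  by rewrite gee0_abs.
apply: (@squeeze_cvge _ _ _ _ (fun=> l%:E) _ (fun k => (l + C / k%:R)%:E)).
- near=> k; have /andP[h1 h2] : (0 <= u k - l%:E <= (C / k%:R)%:E)%E by near: k.
  by rewrite -sube_ge0// h1/= EFinD -leeBlDl.
- exact: cvg_cst.
apply: cvg_EFin; first by near=> k.
rewrite -[X in _ --> X]addr0; apply: cvgD; first exact: cvg_cst.
rewrite -[X in _ --> X](mulr0 C); apply: cvgMl_tmp.
apply/(gtr0_cvgV0 (f := fun k => k%:R)); last exact: cvgr_idn.
by near=> k; rewrite ltr0n; near: k; exact: nbhs_infty_gt.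
Unshelve. all: by end_near.
Qed.

Lemma ler_weighted_dist2 (R : realType) (n p : nat) (K : 'M[R]_(n, p))
    (rho0 gamma a a' b b' : R) : 0 < rho0 -> 0 < gamma < 1 ->
  0 <= a -> a <= a' -> 0 <= b -> b <= b' ->
  weighted_dist2 K rho0 gamma a b <= weighted_dist2 K rho0 gamma a' b'.
Proof.
move=> r0 /andP[g0 g1] a0 aa' b0 bb'.
have aa : a ^+ 2 <= a' ^+ 2 by rewrite lerXn2r// nnegrE// (le_trans a0).
have bb : b ^+ 2 <= b' ^+ 2 by rewrite lerXn2r// nnegrE// (le_trans b0).
apply: lerD; rewrite ler_pM2r ?invr_gt0 ?mulr_gt0 ?subr_gt0//.
rewrite ler_wpM2l//; apply: mulr_ge0; first exact: ltW.
by rewrite exprn_ge0 ?opnorm_ge0.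
Qed.

Theorem theorem3p2 (R : realType) (p n : nat)
    (f : 'cV[R]_p -> \bar R) (g : 'cV[R]_n -> \bar R) (K : 'M[R]_(n, p))
    (hf : proper_closed_convex f) (hg : proper_closed_convex g)
    (hK : K != 0)
    (hsol : primal_sol f g K !=set0)
    (hri : domain_qualification f g K)
    (rho0 gamma : R) (hrho0 : 0 < rho0) (hgamma : 0 < gamma < 1)
    (x0 : 'cV[R]_p) (y0 : 'cV[R]_n)
    (x xh : nat -> 'cV[R]_p) (y yt yb : nat -> 'cV[R]_n)
    (halg : algorithm1 f g K rho0 1 gamma x0 y0 x xh y yt yb) :
  [/\ forall (u : 'cV[R]_p) (v : 'cV[R]_n) (k : nat), (1 <= k)%N ->
        (lagrangian f g K (x k) v - lagrangian f g K u (yb k)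
         <= ((2 * k%:R)^-1 *
             weighted_dist2 K rho0 gamma (enorm (x0 - u)) (enorm (y0 - v)))%:E)%E,
      forall (X : set 'cV[R]_p) (Y : set 'cV[R]_n),
        X !=set0 -> closed X -> convex_set X ->
        Y !=set0 -> closed Y -> convex_set Y ->
        primal_sol f g K `&` X !=set0 -> dual_sol f g K `&` Y !=set0 ->
        let S := ereal_sup
          [set (weighted_dist2 K rho0 gamma (enorm (x0 - u)) (enorm (y0 - v)))%:E
             | u in X & v in Y] in
        (forall k : nat, (1 <= k)%N ->
           (0 <= gap f g K X Y (x k) (yb k) <= ((2 * k%:R)^-1)%:E * S)%E)
        /\ ((S < +oo)%E ->
            cvg_rate_1k (fun k => gap f g K X Y (x k) (yb k)) 0%E),
      forall (Mg : R) (xs : 'cV[R]_p),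
        0 <= Mg -> lipschitz_on_dom Mg g -> primal_sol f g K xs ->
        [/\ forall k : nat, (1 <= k)%N ->
              (0 <= primal_obj f g K (x k) - primal_value f g K)%E,
            forall k : nat, (1 <= k)%N -> dom g (K *m x k) ->
              (primal_obj f g K (x k) - primal_value f g K
               <= ((2 * k%:R)^-1 *
                   weighted_dist2 K rho0 gamma
                     (enorm (x0 - xs)) (ball_dist y0 Mg))%:E)%E
          & (\forall k \near \oo, dom g (K *m x k)) ->
            cvg_rate_1k (fun k => primal_obj f g K (x k)) (primal_value f g K)]
    & forall (Mf : R) (ys : 'cV[R]_n),
        0 <= Mf -> lipschitz_on_dom Mf (fconj f) -> dual_sol f g K ys ->
        [/\ forall k : nat, (1 <= k)%N ->
              (0 <= dual_obj f g K (yb k) - dual_value f g K)%E,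
            forall k : nat, (1 <= k)%N -> dom (fconj f) (- (K^T *m yb k)) ->
              (dual_obj f g K (yb k) - dual_value f g K
               <= ((2 * k%:R)^-1 *
                   weighted_dist2 K rho0 gamma
                     (ball_dist x0 Mf) (enorm (y0 - ys)))%:E)%E
          & (\forall k \near \oo, dom (fconj f) (- (K^T *m yb k))) ->
            cvg_rate_1k (fun k => dual_obj f g K (yb k)) (dual_value f g K)]].
Proof.
have [fP _ /convex_efun_epi fc] := hf; have [gP _ /convex_efun_epi gc] := hg.
have [[fN fD] [gN gD]] := (fP, gP).
have fsP := fconj_proper hf; have gsP := fconj_proper hg.
have fsc := fconj_epi_convex fN; have gsc := fconj_epi_convex gN.
have gapB (u : 'cV[R]_p) (v : 'cV[R]_n) (k : nat) : (1 <= k)%N ->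
    (lagrangian f g K (x k) v - lagrangian f g K u (yb k)
     <= ((2 * k%:R)^-1 *
         weighted_dist2 K rho0 gamma (enorm (x0 - u)) (enorm (y0 - v)))%:E)%E.
  case: k => // k _.
  have [fx _] := prox_x fP fc hK hrho0 hgamma halg k.
  have [gy _] := fconj_yb gsP gsc hrho0 halg k.
  rewrite /lagrangian fx gy.
  (* Outside the domains, the left-hand side is -oo. *)
  case gvE : (fconj g v) => [gv||]; last by have := gsP.1 v; rewrite gvE.
    case fuE : (f u) => [fu||]; last by have := fN u; rewrite fuE.
      have := lagrangian_gap_fin fP fc gsP gsc hK hrho0 hgamma halg fuE gvE k.
      rewrite -!EFinD lee_fin => H.
      by rewrite invfM mulrAC ler_pdivlMr ?ltr0n// mulrC.
    by rewrite addye// addeNy leNye.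
  by rewrite addeNy addNye leNye.
(* The optimal values are c and - c. *)
have [xs0 xs0min] := hsol.
have [c cE [yd ydc]] := strong_duality fP fc gP gc hri xs0min.
have primal_c xs : primal_sol f g K xs -> primal_obj f g K xs = c%:E.
  by move=> xsmin; apply/eqP; rewrite -cE eq_le xsmin xs0min.
have dual_c ys : dual_sol f g K ys -> dual_obj f g K ys = (- c)%:E.
  move=> ysmin; apply/eqP; rewrite eq_le (le_trans (ysmin yd) ydc)/=.
  rewrite EFinN leeNl -cE.
  exact: le_trans (dual_le_lagrangian K fN gN fD gD xs0 ys)
                  (lagrangian_le_primal K fN gN gD xs0 ys).
have rateE (k : nat) (W : R) : (2 * k%:R)^-1 * W = (W / 2) / k%:R.
  by rewrite invfM [RHS]mulrAC mulrC mulrA mulrAC.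
split => //.
- move=> X Y _ _ _ _ _ _ [xs [xsmin Xxs]] [ys [ysmin Yys]] S.
  have bounds (k : nat) : (1 <= k)%N ->
      (0 <= gap f g K X Y (x k) (yb k) <= ((2 * k%:R)^-1)%:E * S)%E.
    move=> k1; apply/andP; split.
      apply: (@le_trans _ _ (lagrangian f g K (x k) ys - lagrangian f g K xs (yb k))%E).
        have h1 := dual_le_lagrangian K fN gN fD gD (x k) ys.
        have h2 := lagrangian_le_primal K fN gN gD xs (yb k).
        rewrite (dual_c _ ysmin) in h1; rewrite (primal_c _ xsmin) in h2.
        apply: le_trans (leeB h1 h2).
        by rewrite -EFinN opprK -EFinB subrr.
      by apply: ereal_sup_ubound; exists xs => //; exists ys.
    apply: ge_ereal_sup => _ [u Xu [v Yv <-]].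
    apply: (le_trans (gapB u v k k1)); rewrite EFinM; apply: lee_wpmul2l.
      by rewrite lee_fin invr_ge0 mulr_ge0.
    by apply: ereal_sup_ubound; exists u => //; exists v.
  split=> // Soo.
  have S_fin : S \is a fin_num.
    rewrite fin_numE gt_eqF ?lt_eqF//.
    apply: (@lt_le_trans _ _ (weighted_dist2 K rho0 gamma
      (enorm (x0 - xs)) (enorm (y0 - ys)))%:E); first exact: ltNyr.
    by apply: ereal_sup_ubound; exists xs => //; exists ys.
  apply: (cvg_rate_1k_bound (C := fine S / 2)); near=> k.
  rewrite sube0 -rateE EFinM fineK//; apply: bounds.
  by near: k; exact: nbhs_infty_ge.
- move=> Mg xs Mg0 gL xsmin.
  have pv : primal_value f g K = c%:E.
    by rewrite /primal_value (ereal_inf_argmin xsmin) primal_c.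
  have lb (k : nat) : (0 <= primal_obj f g K (x k) - primal_value f g K)%E.
    by rewrite pv sube_ge0 ?orbT// -(primal_c _ xsmin).
  have ub (k : nat) : (1 <= k)%N -> dom g (K *m x k) ->
      (primal_obj f g K (x k) - primal_value f g K
        <= ((2 * k%:R)^-1 * weighted_dist2 K rho0 gamma
             (enorm (x0 - xs)) (ball_dist y0 Mg))%:E)%E.
    move=> k1 /(domP gN)[b gb].
    (* By equality in Young's inequality, L (x k, v) = F (x k) at this v. *)
    have [v vM vb] := lipschitz_subgradient gc gP Mg0 gL gb.
    apply: (@le_trans _ _ (lagrangian f g K (x k) v - lagrangian f g K xs (yb k))%E).
      apply: leeB.
        rewrite /primal_obj /lagrangian gb.
        case: (fconj g v) (gsP.1 v) vb => [s||]// _; rewrite lee_fin => vb.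
        rewrite -addeA leeD2l// -EFinB lee_fin dotC; lra.
      by rewrite pv -(primal_c _ xsmin); exact: lagrangian_le_primal.
    apply: (le_trans (gapB xs v k k1)); rewrite lee_fin ler_wpM2l ?invr_ge0 ?mulr_ge0//.
    by apply: ler_weighted_dist2; rewrite ?enorm_ge0 ?enorm_le_ball_dist.
  split=> // dk; rewrite pv.
  apply: (cvg_rate_1k_bound (C := weighted_dist2 K rho0 gamma
    (enorm (x0 - xs)) (ball_dist y0 Mg) / 2)).
  near=> k; rewrite -pv lb -rateE/=; apply: ub.
    by near: k; exact: nbhs_infty_ge.
  by near: k.
- move=> Mf ys Mf0 fL ysmin.
  have dv : dual_value f g K = (- c)%:E.
    by rewrite /dual_value (ereal_inf_argmin ysmin) dual_c.
  have lb (k : nat) : (0 <= dual_obj f g K (yb k) - dual_value f g K)%E.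
    by rewrite dv sube_ge0 ?orbT// -(dual_c _ ysmin).
  have ub (k : nat) : (1 <= k)%N -> dom (fconj f) (- (K^T *m yb k)) ->
      (dual_obj f g K (yb k) - dual_value f g K
        <= ((2 * k%:R)^-1 * weighted_dist2 K rho0 gamma
             (ball_dist x0 Mf) (enorm (y0 - ys)))%:E)%E.
    move=> k1 /(domP fsP.1)[a fa].
    (* At this u, f^** and f agree, and L (u, yb k) = - G (yb k). *)
    have [u uM ua] := lipschitz_subgradient fsc fsP Mf0 fL fa.
    have {}ua := le_trans (le_biconj u hf) ua.
    apply: (@le_trans _ _ (lagrangian f g K (x k) ys - lagrangian f g K u (yb k))%E).
      rewrite addeC; apply: leeD.
        rewrite dv -(dual_c _ ysmin); exact: dual_le_lagrangian.
      rewrite leeNr /dual_obj /lagrangian fa.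
      have := gsP.1 (yb k); case: (fconj g (yb k)) => [s||]// _.
        move: ua; case: (f u) (fN u) => [r||]// _.
        rewrite lee_fin dotNr dot_trmx -!EFinD -EFinN lee_fin; lra.
      by rewrite addeNy leNye.
    apply: (le_trans (gapB u ys k k1)); rewrite lee_fin ler_wpM2l ?invr_ge0 ?mulr_ge0//.
    by apply: ler_weighted_dist2; rewrite ?enorm_ge0 ?enorm_le_ball_dist.
  split=> // dk; rewrite dv.
  apply: (cvg_rate_1k_bound (C := weighted_dist2 K rho0 gamma
    (ball_dist x0 Mf) (enorm (y0 - ys)) / 2)).
  near=> k; rewrite -dv lb -rateE/=; apply: ub.
    by near: k; exact: nbhs_infty_ge.
  by near: k.
Unshelve. all: by end_near.
Qed.
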